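(* Let $p>0$, let $h$ satisfy $\lim_{t\to\infty}\frac{h'(t)}{t^{p-1}h(t)}=0$, and let $\{(\lambda_n,\mu_n,u_n)\}$ be a sequence of solutions (in the sense of the context) with $\mu_n\to\infty$ as $n\to\infty$. Let $(\gamma_{0,n})$ be the sequence of positive numbers with $p\lambda_n\mu_n^{p-1}f(\mu_n)\gamma_{0,n}^2=1$ and put $z_{0,n}(r)=p\mu_n^{p-1}(u_n(\gamma_{0,n}r)-\mu_n)$ for $r\in[0,1/\gamma_{0,n}]$. Then, up to a subsequence, there exists a sequence $(\rho_{0,n})\subset(0,1)$ such that $\gamma_{0,n}\to0$, $\rho_{0,n}\to0$, $\rho_{0,n}/\gamma_{0,n}\to\infty$, $u_n(\rho_{0,n})/\mu_n\to1$, and $\|z_{0,n}-z_0\|_{C^1([0,\rho_{0,n}/\gamma_{0,n}])}\to0$, where \[ z_0(r)=\log\frac{64}{(8+r^2)^2}\quad (r\in[0,\infty)), \] which satisfies $-z_0''-\frac1r z_0'=e^{z_0}$ in $(0,\infty)$, $z_0(0)=0=z_0'(0)$; and further \[ p\mu_n^{p-1}\int_0^{\rho_{0,n}}\lambda_n f(u_n)\,r\,dr\to\int_0^\infty e^{z_0}r\,dr=4 \] as $n\to\infty$. Moreover, there exists a sequence $(r_{0,n})\subset(0,\rho_{0,n})$ (i.e. $0<r_{0,n}<\rho_{0,n}$) such that $r_{0,n}/\gamma_{0,n}\to2\sqrt2$, $u_n(r_{0,n})/\mu_n\to1$, and $p\lambda_n r_{0,n}^2u_n(r_{0,n})^{p-1}f(u_n(r_{0,n}))\to2$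 as $n\to\infty$.
   Context: $h:[0,\infty)\to\mathbb{R}$ is a nonnegative $C^1$ function and there is $t_0>0$ with $h(t)>0$ for all $t\ge t_0$; $f(t)=h(t)e^{t^p}$. A sequence of solutions $\{(\lambda_n,\mu_n,u_n)\}$ means: for every $n\in\mathbb N$, $\lambda_n>0$, $\mu_n>0$, and $u_n$ is a classical solution on $[0,1]$ of $-u_n''-\frac1r u_n'=\lambda_nf(u_n)$, $u_n>0$ in $(0,1)$, $u_n(0)=\mu_n$, $u_n'(0)=0=u_n(1)$. ''Up to a subsequence'' means after passing to a subsequence in $n$, not relabelled. ($\gamma_{0,n}$ is defined once $f(\mu_n)>0$, i.e. for all large $n$.) *)

(* Defs.v *)
From Stdlib Require Import Reals Lra.
From Coquelicot Require Import Coquelicot.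
Open Scope R_scope.

Definition Icc (a b : R) : R -> Prop := fun x => a <= x <= b.
Definition Ici (a : R) : R -> Prop := fun x => a <= x.

(* Calculus on a closed interval D (one-sided at its endpoints).  A function
   on D is a total function on R whose values off D are irrelevant: only its
   restriction to D enters the definitions below, at points of D. *)
Definition is_derive_on (D : R -> Prop) (g : R -> R) (x l : R) : Prop :=
  filterdiff g (within D (locally x)) (fun y : R => scal y l).

Definition ex_derive_on (D : R -> Prop) (g : R -> R) (x : R) : Prop :=
  exists l : R, is_derive_on D g x l.

Definition Derive_on (D : R -> Prop) (g : R -> R) (x : R) : R :=
  iota (fun l : R => is_derive_on D g x l).

Definition C1_on (D : R -> Prop) (g : R -> R) : Prop :=
  (forall x, D x -> ex_derive_on D g x) /\ continuous_on D (Derive_on D g).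

Definition C2_on (D : R -> Prop) (g : R -> R) : Prop :=
  C1_on D g /\ C1_on D (Derive_on D g).

Definition sup_norm (D : R -> Prop) (g : R -> R) : Rbar :=
  Lub_Rbar (fun y => exists x, D x /\ y = Rabs (g x)).

Definition C1_norm (D : R -> Prop) (g : R -> R) : Rbar :=
  Rbar_plus (sup_norm D g) (sup_norm D (Derive_on D g)).

(* t^p for t >= 0 and p > 0.  Rpower alone is wrong at t = 0: since ln 0 = 0
   in Stdlib, Rpower 0 p = 1. *)
Definition rpow (t p : R) : R := if Rlt_dec 0 t then Rpower t p else 0.

Definition nonlin (p : R) (h : R -> R) (t : R) : R := h t * exp (rpow t p).

Definition is_solution (f : R -> R) (lam mu : R) (u : R -> R) : Prop :=
  0 < lam /\ 0 < mu /\
  C2_on (Icc 0 1) u /\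
  (forall r, 0 < r < 1 ->
     - Derive_on (Icc 0 1) (Derive_on (Icc 0 1) u) r
     - / r * Derive_on (Icc 0 1) u r = lam * f (u r)) /\
  (forall r, 0 < r < 1 -> 0 < u r) /\
  u 0 = mu /\ Derive_on (Icc 0 1) u 0 = 0 /\ u 1 = 0.

Definition rescaled (p mu gam : R) (u : R -> R) (r : R) : R :=
  p * Rpower mu (p - 1) * (u (gam * r) - mu).

Definition z0 (r : R) : R := ln (64 / (8 + r ^ 2) ^ 2).

Lemma is_derive_on_interior (D : R -> Prop) (g : R -> R) (x l : R) :
  locally x D -> is_derive_on D g x l <-> is_derive g x l.
Proof.
intros HD; split; intros [Hl H]; split; try exact Hl; intros y Hy.
- assert (Hy' : is_filter_lim (within D (locally x)) y).
  { intros P HP; apply (filter_imp (F := locally x) P); [auto | exact (Hy P HP)]. }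
  intros eps; generalize (filter_and _ _ HD (H y Hy' eps)).
  apply filter_imp; intros z [Hz1 Hz2]; exact (Hz2 Hz1).
- assert (Hy' : is_filter_lim (locally x) y).
  { intros P HP; generalize (filter_and _ _ HD (Hy P HP)).
    apply filter_imp; intros z [Hz1 Hz2]; exact (Hz2 Hz1). }
  intros eps; eapply (filter_imp (F := locally x)); [| exact (H y Hy' eps)]; auto.
Qed.

Lemma is_derive_on_unique (D : R -> Prop) (g : R -> R) (x l : R) :
  (forall e : posreal, exists y, D y /\ y <> x /\ Rabs (y - x) < e) ->
  is_derive_on D g x l -> Derive_on D g x = l.
Proof.
intros Hacc Hl.
assert (Hlim : is_filter_lim (within D (locally x)) x).
{ intros P HP; apply (filter_imp (F := locally x) P); [auto | exact HP]. }
apply (iota_unique (V := R_CompleteNormedModule)); [| exact Hl].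
intros m Hm.
destruct Hl as [_ Hl]; destruct Hm as [_ Hm].
specialize (Hl x Hlim); specialize (Hm x Hlim).
destruct (Req_dec m l) as [E | E]; [exact E | exfalso].
assert (He : 0 < Rabs (m - l) / 4)
  by (apply Rdiv_lt_0_compat; [apply Rabs_pos_lt; lra | lra]).
pose (e := mkposreal _ He).
destruct (filter_and _ _ (Hl e) (Hm e)) as [d Hd].
destruct (Hacc d) as [y [Dy [Ny By]]].
destruct (Hd y By Dy) as [H1 H2].
change (Rabs ((g y - g x) - (y - x) * l) <= Rabs (m - l) / 4 * Rabs (y - x)) in H1.
change (Rabs ((g y - g x) - (y - x) * m) <= Rabs (m - l) / 4 * Rabs (y - x)) in H2.
assert (Hp : 0 < Rabs (y - x)) by (apply Rabs_pos_lt; lra).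
assert (T : Rabs ((m - l) * (y - x)) <= 2 * (Rabs (m - l) / 4 * Rabs (y - x))).
{ replace ((m - l) * (y - x)) with
    ((g y - g x - (y - x) * l) - (g y - g x - (y - x) * m)) by ring.
  eapply Rle_trans; [apply Rabs_triang |].
  rewrite Rabs_Ropp; lra. }
rewrite Rabs_mult in T; nra.
Qed.

(* Main.v *)
(* The rescaled function Z(r) = p mu^(p-1) (u(gamma r) - mu), with derivative V,
   solves V' = - G - V/r, where G(r) = f(u(gamma r)) / f(mu).  For large mu the
   maximum of f on [0, mu] is f(mu), so 0 <= G <= 1 and hence -r^2/4 <= Z <= 0.
   Evaluated at r = 1/gamma, where u = 0, this yields gamma -> 0.  On a fixed
   interval [0, R] it confines Z to a bounded set, on which the hypothesis on
   h'/h gives G = e^Z + o(1) uniformly; Gronwall's lemma then compares Z with z0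
   in C^1, without any compactness argument.  Letting R grow along a diagonal
   subsequence defines rho = R gamma, and the mass in [0, rho] is the flux
   - R V(R), close to - R z0'(R) -> 4. *)
Require Import Defs.
From Stdlib Require Import Reals Lra Lia ClassicalEpsilon.
From Coquelicot Require Import Coquelicot.
Open Scope R_scope.

(** * Calculus on intervals *)

Lemma is_derive_on_eps (D : R -> Prop) (g : R -> R) (x l : R) :
  D x ->
  is_derive_on D g x l <->
  forall eps, 0 < eps -> exists d : posreal, forall y, D y -> Rabs (y - x) < d ->
    Rabs (g y - g x - (y - x) * l) <= eps * Rabs (y - x).
Proof.
intros Dx; split.
- intros [_ H] eps Heps.
  assert (Hlim : is_filter_lim (within D (locally x)) x).
  { intros P HP; apply (filter_imp (F := locally x) P); [auto | exact HP]. }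
  destruct (H x Hlim (mkposreal _ Heps)) as [d Hd].
  exists d; intros y Dy By; exact (Hd y By Dy).
- intros H; split; [apply (is_linear_scal_l (K := R_AbsRing) (V := R_NormedModule) l) |].
  intros y Hy.
  assert (E : y = x).
  { destruct (Req_dec y x) as [E | E]; [exact E | exfalso].
    assert (Hp : 0 < Rabs (x - y)) by (apply Rabs_pos_lt; lra).
    destruct (Hy (fun z => Rabs (z - y) < Rabs (x - y))) as [d Hd].
    - exists (mkposreal _ Hp); intros z Hz; exact Hz.
    - specialize (Hd x (ball_center x d) Dx); lra. }
  subst y; intros eps.
  destruct (H eps (cond_pos eps)) as [d Hd].
  exists d; intros y By Dy; exact (Hd y Dy By).
Qed.

Lemma is_derive_is_derive_on (D : R -> Prop) (g : R -> R) (x l : R) :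
  D x -> is_derive g x l -> is_derive_on D g x l.
Proof.
intros Dx [_ H]; apply is_derive_on_eps; [exact Dx |]; intros eps Heps.
destruct (H x (fun P HP => HP) (mkposreal _ Heps)) as [d Hd].
exists d; intros y _ Hy; exact (Hd y Hy).
Qed.

Lemma Derive_on_correct (D : R -> Prop) (g : R -> R) (x : R) :
  (forall e : posreal, exists y, D y /\ y <> x /\ Rabs (y - x) < e) ->
  ex_derive_on D g x -> is_derive_on D g x (Derive_on D g x).
Proof.
intros Hacc [l Hl].
rewrite (is_derive_on_unique D g x l Hacc Hl); exact Hl.
Qed.

Lemma Icc_accumulation (a b x : R) : a < b -> Icc a b x ->
  forall e : posreal, exists y, Icc a b y /\ y <> x /\ Rabs (y - x) < e.
Proof.
intros Hab [H1 H2] e; assert (He := cond_pos e).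
destruct (Rlt_dec x b) as [H | H].
- assert (0 < Rmin (e / 2) (b - x)) by (apply Rmin_pos; lra).
  assert (J1 := Rmin_l (e / 2) (b - x)); assert (J2 := Rmin_r (e / 2) (b - x)).
  exists (x + Rmin (e / 2) (b - x)); split; [split; lra | split; [lra |]].
  rewrite Rabs_pos_eq; lra.
- assert (0 < Rmin (e / 2) (x - a)) by (apply Rmin_pos; lra).
  assert (J1 := Rmin_l (e / 2) (x - a)); assert (J2 := Rmin_r (e / 2) (x - a)).
  exists (x - Rmin (e / 2) (x - a)); split; [split; lra | split; [lra |]].
  rewrite Rabs_left; lra.
Qed.

Lemma Ici_accumulation (a x : R) : Ici a x ->
  forall e : posreal, exists y, Ici a y /\ y <> x /\ Rabs (y - x) < e.
Proof.
intros H e; assert (He := cond_pos e); unfold Ici in *.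
exists (x + e / 2); split; [lra | split; [lra |]].
rewrite Rabs_pos_eq; lra.
Qed.

Lemma Icc_interior (a b x : R) : a < x < b -> locally x (Icc a b).
Proof.
intros H; assert (Hp : 0 < Rmin (x - a) (b - x)) by (apply Rmin_pos; lra).
exists (mkposreal _ Hp); intros y Hy.
change (Rabs (y - x) < Rmin (x - a) (b - x)) in Hy.
assert (J1 := Rmin_l (x - a) (b - x)); assert (J2 := Rmin_r (x - a) (b - x)).
apply Rabs_def2 in Hy; split; lra.
Qed.

Lemma Ici_interior (a x : R) : a < x -> locally x (Ici a).
Proof.
intros H; assert (Hp : 0 < x - a) by lra.
exists (mkposreal _ Hp); intros y Hy.
change (Rabs (y - x) < x - a) in Hy.
apply Rabs_def2 in Hy; unfold Ici; lra.
Qed.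

Lemma is_derive_on_continuous (D : R -> Prop) (g : R -> R) (x l : R) :
  D x -> is_derive_on D g x l ->
  filterlim g (within D (locally x)) (locally (g x)).
Proof.
intros Dx H; apply filterlim_locally; intros eps.
rewrite is_derive_on_eps in H by exact Dx.
destruct (H 1 Rlt_0_1) as [d Hd].
assert (Hl := Rabs_pos l).
assert (He : 0 < eps / (1 + Rabs l)) by (apply Rdiv_lt_0_compat; [apply cond_pos | lra]).
assert (Hp : 0 < Rmin d (eps / (1 + Rabs l))) by (apply Rmin_pos; [apply cond_pos | exact He]).
exists (mkposreal _ Hp); intros y By Dy.
change (Rabs (y - x) < Rmin d (eps / (1 + Rabs l))) in By.
assert (J1 := Rmin_l d (eps / (1 + Rabs l))); assert (J2 := Rmin_r d (eps / (1 + Rabs l))).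
specialize (Hd y Dy (Rlt_le_trans _ _ _ By J1)).
change (Rabs (g y - g x) < eps).
replace (g y - g x) with ((g y - g x - (y - x) * l) + (y - x) * l) by ring.
eapply Rle_lt_trans; [apply Rabs_triang |]; rewrite Rabs_mult.
assert (E : eps = eps / (1 + Rabs l) * (1 + Rabs l) :> R) by (field; lra).
rewrite E; nra.
Qed.

Lemma within_at_right (D : R -> Prop) (F : R -> R) (l : R) :
  at_right 0 D -> filterlim F (within D (locally 0)) (locally l) ->
  filterlim F (at_right 0) (locally l).
Proof.
intros HD; apply filterlim_filter_le_1.
intros P HP; unfold at_right, within in *.
generalize (filter_and _ _ HD HP); apply filter_imp; intuition.
Qed.

Lemma nonneg_of_derive_nonneg (H dH : R -> R) (T : R) :
  (forall x, 0 < x < T -> is_derive H x (dH x)) ->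
  (forall x, 0 < x < T -> 0 <= dH x) ->
  filterlim H (at_right 0) (locally 0) ->
  forall x, 0 < x < T -> 0 <= H x.
Proof.
intros HD Hpos H0 x Hx.
destruct (Rle_dec 0 (H x)) as [h | h]; [exact h | exfalso].
assert (He : 0 < - H x) by lra.
destruct (proj1 (filterlim_locally _ _) H0 (mkposreal _ He)) as [d Hd].
set (s := Rmin (d / 2) (x / 2)).
assert (Hd0 := cond_pos d).
assert (Hs : 0 < s) by (apply Rmin_pos; lra).
assert (J1 : s <= d / 2) by apply Rmin_l; assert (J2 : s <= x / 2) by apply Rmin_r.
assert (Bs : Rabs (H s - 0) < - H x).
{ apply Hd; [| exact Hs]. change (Rabs (s - 0) < d). rewrite Rabs_pos_eq; lra. }
destruct (MVT_cor2 H dH s x) as [c [E Hc]]; [lra | |].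
- intros c Hc; apply is_derive_Reals, HD; lra.
- assert (0 <= dH c) by (apply Hpos; lra).
  apply Rabs_def2 in Bs; nra.
Qed.

(** * The radial equation *)

Lemma is_derive_radial (V G : R -> R) (x : R) :
  0 < x -> is_derive V x (- G x - V x / x) ->
  is_derive (fun y => y * V y) x (- (x * G x)).
Proof.
intros Hx HV; evar_last.
- apply (is_derive_mult (fun y => y) V x 1 (- G x - V x / x)).
  + apply (is_derive_id (K := R_AbsRing)).
  + exact HV.
  + intros; apply Rmult_comm.
- unfold plus, mult; simpl; field; lra.
Qed.

Lemma filterlim_id_at_right : filterlim (fun x : R => x) (at_right 0) (locally 0).
Proof.
intros P HP; unfold filtermap, at_right, within.
revert HP; apply filter_imp; auto.
Qed.

Lemma continuous_at_right (g : R -> R) (l : R) :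
  continuous g 0 -> g 0 = l -> filterlim g (at_right 0) (locally l).
Proof.
intros Hg <-; eapply filterlim_comp; [apply filterlim_id_at_right | exact Hg].
Qed.

Lemma vanish_mult_id (V : R -> R) :
  filterlim V (at_right 0) (locally 0) ->
  filterlim (fun x => x * V x) (at_right 0) (locally 0).
Proof.
intros HV; replace 0 with (0 * 0) at 2 by ring.
apply (filterlim_comp_2 (F := at_right 0) (G := locally 0) (H := locally 0)
  (fun x => x) V Rmult).
- apply filterlim_id_at_right.
- exact HV.
- apply (filterlim_mult (K := R_AbsRing) 0 0).
Qed.

Lemma vanish_plus (F G : R -> R) :
  filterlim F (at_right 0) (locally 0) -> filterlim G (at_right 0) (locally 0) ->
  filterlim (fun x => F x + G x) (at_right 0) (locally 0).
Proof.
intros HF HG; replace 0 with (0 + 0) at 2 by ring.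
apply (filterlim_comp_2 (F := at_right 0) (G := locally 0) (H := locally 0) F G Rplus);
  [exact HF | exact HG | apply (filterlim_plus (V := R_NormedModule) 0 0)].
Qed.

Lemma vanish_opp (F : R -> R) :
  filterlim F (at_right 0) (locally 0) ->
  filterlim (fun x => - F x) (at_right 0) (locally 0).
Proof.
intros HF; replace 0 with (- 0) at 2 by ring.
apply (filterlim_comp _ _ _ F Ropp (at_right 0) (locally 0));
  [exact HF | apply (filterlim_opp (V := R_NormedModule) 0)].
Qed.

Lemma abs_le_of_derive_abs_le (F dF g dg : R -> R) (T : R) :
  (forall x, 0 < x < T -> is_derive F x (dF x)) ->
  (forall x, 0 < x < T -> is_derive g x (dg x)) ->
  (forall x, 0 < x < T -> Rabs (dF x) <= dg x) ->
  filterlim F (at_right 0) (locally 0) ->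
  filterlim g (at_right 0) (locally 0) ->
  forall x, 0 < x < T -> Rabs (F x) <= g x.
Proof.
intros HF Hg Hb F0 g0 x Hx.
assert (0 <= g x + - F x).
{ apply (nonneg_of_derive_nonneg (fun y => g y + - F y) (fun y => dg y + - dF y) T); try exact Hx.
  - intros y Hy; apply (is_derive_plus (K := R_AbsRing) (V := R_NormedModule)); [auto |].
    apply (is_derive_opp (K := R_AbsRing) (V := R_NormedModule)); auto.
  - intros y Hy; specialize (Hb y Hy); apply Rabs_le_between in Hb; lra.
  - apply vanish_plus; [exact g0 | apply vanish_opp, F0]. }
assert (0 <= g x + F x).
{ apply (nonneg_of_derive_nonneg (fun y => g y + F y) (fun y => dg y + dF y) T); try exact Hx.
  - intros y Hy; apply (is_derive_plus (K := R_AbsRing) (V := R_NormedModule)); auto.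
  - intros y Hy; specialize (Hb y Hy); apply Rabs_le_between in Hb; lra.
  - apply vanish_plus; [exact g0 | exact F0]. }
apply Rabs_le; lra.
Qed.

Lemma radial_gradient_bound (V G : R -> R) (T B : R) :
  (forall x, 0 < x < T -> is_derive V x (- G x - V x / x)) ->
  filterlim V (at_right 0) (locally 0) ->
  (forall x, 0 < x < T -> Rabs (G x) <= B) ->
  forall x, 0 < x < T -> Rabs (V x) <= x * B / 2.
Proof.
intros HV V0 HG x Hx.
assert (H : Rabs (x * V x) <= x ^ 2 * B / 2).
{ apply (abs_le_of_derive_abs_le (fun y => y * V y) (fun y => - (y * G y))
    (fun y => y ^ 2 * B / 2) (fun y => y * B) T); try exact Hx.
  - intros y Hy; apply is_derive_radial; [lra | auto].
  - intros y Hy; auto_derive; [exact I | field].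
  - intros y Hy; rewrite Rabs_Ropp, Rabs_mult, Rabs_pos_eq by lra.
    apply Rmult_le_compat_l; [lra | auto].
  - apply vanish_mult_id, V0.
  - apply continuous_at_right; [| field].
    apply (ex_derive_continuous (K := R_AbsRing) (V := R_NormedModule)).
    auto_derive; exact I. }
rewrite Rabs_mult, Rabs_pos_eq in H by lra.
apply Rmult_le_reg_l with x; nra.
Qed.

Lemma radial_nonpos (Z V G : R -> R) (T : R) :
  (forall x, 0 < x < T -> is_derive Z x (V x)) ->
  (forall x, 0 < x < T -> is_derive V x (- G x - V x / x)) ->
  filterlim Z (at_right 0) (locally 0) -> filterlim V (at_right 0) (locally 0) ->
  (forall x, 0 < x < T -> 0 <= G x) ->
  forall x, 0 < x < T -> V x <= 0 /\ Z x <= 0.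
Proof.
intros HZ HV Z0 V0 HG.
assert (A : forall x, 0 < x < T -> V x <= 0).
{ intros x Hx.
  assert (H : 0 <= - (x * V x)).
  { apply (nonneg_of_derive_nonneg (fun y => - (y * V y)) (fun y => y * G y) T); try exact Hx.
    - intros y Hy; rewrite <- (Ropp_involutive (y * G y)).
      apply (is_derive_opp (K := R_AbsRing) (V := R_NormedModule) (fun y => y * V y)).
      apply is_derive_radial; [lra | auto].
    - intros y Hy; specialize (HG y Hy); nra.
    - apply vanish_opp, vanish_mult_id, V0. }
  nra. }
intros x Hx; split; [auto |].
assert (H : 0 <= - Z x).
{ apply (nonneg_of_derive_nonneg (fun y => - Z y) (fun y => - V y) T); try exact Hx.
  - intros y Hy; apply (is_derive_opp (K := R_AbsRing) (V := R_NormedModule)); auto.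
  - intros y Hy; specialize (A y Hy); lra.
  - apply vanish_opp, Z0. }
lra.
Qed.

Lemma radial_lower_bound (Z V G : R -> R) (T : R) :
  (forall x, 0 < x < T -> is_derive Z x (V x)) ->
  (forall x, 0 < x < T -> is_derive V x (- G x - V x / x)) ->
  filterlim Z (at_right 0) (locally 0) -> filterlim V (at_right 0) (locally 0) ->
  (forall x, 0 < x < T -> 0 <= G x <= 1) ->
  forall x, 0 < x < T -> Rabs (Z x) <= x ^ 2 / 4.
Proof.
intros HZ HV Z0 V0 HG x Hx.
apply (abs_le_of_derive_abs_le Z V (fun y => y ^ 2 / 4) (fun y => y * 1 / 2) T); try assumption.
- intros y Hy; auto_derive; [exact I | field].
- apply (radial_gradient_bound V G T 1); try assumption.
  intros y Hy; specialize (HG y Hy); apply Rabs_le; lra.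
- apply continuous_at_right; [| field].
  apply (ex_derive_continuous (K := R_AbsRing) (V := R_NormedModule)).
  auto_derive; exact I.
Qed.

Definition z0' (r : R) : R := - (4 * r) / (8 + r ^ 2).
Definition z0'' (r : R) : R := - (4 * (8 - r ^ 2)) / (8 + r ^ 2) ^ 2.

Lemma denominator_pos (r : R) : 0 < 8 + r ^ 2.
Proof. nra. Qed.

Lemma is_derive_z0 (r : R) : is_derive z0 r (z0' r).
Proof.
assert (H := denominator_pos r).
unfold z0, z0'; auto_derive.
- split; [nra |]. split; [| exact I].
  apply Rdiv_lt_0_compat; nra.
- field. lra.
Qed.

Lemma is_derive_z0' (r : R) : is_derive z0' r (z0'' r).
Proof.
assert (H := denominator_pos r).
unfold z0', z0''; auto_derive; [nra | field; lra].
Qed.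

Lemma exp_z0 (r : R) : exp (z0 r) = 64 / (8 + r ^ 2) ^ 2.
Proof.
assert (H := denominator_pos r).
unfold z0; rewrite exp_ln; [reflexivity |].
apply Rdiv_lt_0_compat; nra.
Qed.

Lemma z0_equation (r : R) : 0 < r -> z0'' r = - exp (z0 r) - z0' r / r.
Proof.
intros Hr; assert (H := denominator_pos r).
rewrite exp_z0; unfold z0', z0''; field; lra.
Qed.

Lemma z0_0 : z0 0 = 0.
Proof.
unfold z0; replace (64 / (8 + 0 ^ 2) ^ 2) with 1 by field; apply ln_1.
Qed.

Lemma z0_nonpos (r : R) : z0 r <= 0.
Proof.
assert (H : exp (z0 r) <= exp 0).
{ rewrite exp_z0, exp_0.
  assert (H := denominator_pos r).
  apply Rmult_le_reg_r with ((8 + r ^ 2) ^ 2); [nra |].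
  unfold Rdiv; rewrite Rmult_assoc, Rinv_l by nra; nra. }
destruct (Rle_dec (z0 r) 0) as [h | h]; [exact h |].
assert (exp 0 < exp (z0 r)) by (apply exp_increasing; lra); lra.
Qed.

Lemma z0_at_right : filterlim z0 (at_right 0) (locally 0).
Proof.
apply continuous_at_right; [| apply z0_0].
apply (ex_derive_continuous (K := R_AbsRing) (V := R_NormedModule)).
eexists; apply is_derive_z0.
Qed.

Lemma z0'_at_right : filterlim z0' (at_right 0) (locally 0).
Proof.
apply continuous_at_right; [| unfold z0'; field].
apply (ex_derive_continuous (K := R_AbsRing) (V := R_NormedModule)).
eexists; apply is_derive_z0'.
Qed.

Lemma exp_lipschitz_nonpos (a b : R) : a <= 0 -> b <= 0 -> Rabs (exp a - exp b) <= Rabs (a - b).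
Proof.
assert (A : forall a b, a <= b -> b <= 0 -> 0 <= exp b - exp a <= b - a).
{ intros x y Hxy Hy.
  destruct (Req_dec x y) as [-> | E]; [lra |].
  destruct (MVT_cor2 exp exp x y) as [c [E' Hc]]; [lra | intros; apply derivable_pt_lim_exp |].
  assert (0 < exp c) by apply exp_pos.
  assert (exp c < exp 0) by (apply exp_increasing; lra).
  rewrite exp_0 in *; nra. }
intros Ha Hb; destruct (Rle_dec a b) as [h | h].
- specialize (A a b h Hb); rewrite Rabs_minus_sym, (Rabs_minus_sym a), !Rabs_pos_eq; lra.
- assert (h' : b <= a) by lra. specialize (A b a h' Ha); rewrite !Rabs_pos_eq; lra.
Qed.

(* Gronwall by a weighted sup norm: for [M = sup |Z - z0| exp (- x^2/2)],
   integrating the equation for [Z - z0] twice gives [M <= M/2 + eps T^2/4]. *)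
Lemma radial_stability (Z V G : R -> R) (T eps : R) :
  0 < T -> 0 <= eps ->
  (forall x, 0 < x < T -> is_derive Z x (V x)) ->
  (forall x, 0 < x < T -> is_derive V x (- G x - V x / x)) ->
  filterlim Z (at_right 0) (locally 0) -> filterlim V (at_right 0) (locally 0) ->
  (forall x, 0 < x < T -> 0 <= G x <= 1) ->
  (forall x, 0 < x < T -> Rabs (G x - exp (Z x)) <= eps) ->
  forall x, 0 < x < T ->
    Rabs (Z x - z0 x) <= eps * (T ^ 2 / 2 * exp (T ^ 2 / 2)) /\
    Rabs (V x - z0' x) <= eps * (T / 2 * (T ^ 2 / 2 * exp (T ^ 2 / 2) + 1)).
Proof.
intros HT Heps HZ HV Z0 V0 HG HGe.
assert (Znp : forall x, 0 < x < T -> Z x <= 0).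
{ intros x Hx; apply (radial_nonpos Z V G T); try assumption.
  intros y Hy; apply HG, Hy. }
set (W := fun x => Z x + - z0 x). set (D := fun x => V x + - z0' x).
assert (HW : forall x, 0 < x < T -> is_derive W x (D x)).
{ intros x Hx; apply (is_derive_plus (K := R_AbsRing) (V := R_NormedModule)); [auto |].
  apply (is_derive_opp (K := R_AbsRing) (V := R_NormedModule)), is_derive_z0. }
assert (HD : forall x, 0 < x < T -> is_derive D x (- (G x - exp (z0 x)) - D x / x)).
{ intros x Hx; unfold D; evar_last.
  - apply (is_derive_plus (K := R_AbsRing) (V := R_NormedModule)); [apply HV, Hx |].
    apply (is_derive_opp (K := R_AbsRing) (V := R_NormedModule)), is_derive_z0'.
  - rewrite z0_equation by lra; unfold plus, opp; simpl; field; lra. }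
assert (W0 : filterlim W (at_right 0) (locally 0)).
{ apply vanish_plus; [exact Z0 | apply vanish_opp, z0_at_right]. }
assert (D0 : filterlim D (at_right 0) (locally 0)).
{ apply vanish_plus; [exact V0 | apply vanish_opp, z0'_at_right]. }
assert (HGW : forall x, 0 < x < T -> Rabs (G x - exp (z0 x)) <= Rabs (W x) + eps).
{ intros x Hx.
  replace (G x - exp (z0 x)) with ((exp (Z x) - exp (z0 x)) + (G x - exp (Z x))) by ring.
  eapply Rle_trans; [apply Rabs_triang |]; apply Rplus_le_compat; [| auto].
  apply exp_lipschitz_nonpos; [auto | apply z0_nonpos]. }
assert (Dbound : forall M, (forall x, 0 < x < T -> Rabs (W x) <= M * exp (x ^ 2 / 2)) -> 0 <= M ->
   forall x, 0 < x < T -> Rabs (D x) <= x / 2 * (M * exp (x ^ 2 / 2) + eps)).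
{ intros M HM HM0 x Hx.
  assert (HM' : forall y, 0 < y <= x -> M * exp (y ^ 2 / 2) <= M * exp (x ^ 2 / 2)).
  { intros y Hy; apply Rmult_le_compat_l; [exact HM0 |].
    destruct (Req_dec y x) as [-> | E]; [apply Rle_refl |].
    apply Rlt_le, exp_increasing; nra. }
  (* the bound is first obtained on [(0, x)] and passes to [x] by continuity *)
  apply le_epsilon; intros e He.
  assert (Dc : continuous D x).
  { apply (ex_derive_continuous (K := R_AbsRing) (V := R_NormedModule)).
    eexists; apply HD, Hx. }
  destruct (proj1 (filterlim_locally _ _) Dc (mkposreal _ He)) as [d Hd].
  set (s := Rmax (x / 2) (x - d / 2)). assert (Hd0 := cond_pos d).
  assert (J1 : x / 2 <= s) by apply Rmax_l. assert (J2 : x - d / 2 <= s) by apply Rmax_r.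
  assert (J3 : s < x) by (apply Rmax_lub_lt; lra).
  assert (Bs : Rabs (D s - D x) < e).
  { apply (Hd s). change (Rabs (s - x) < d). rewrite Rabs_left; lra. }
  assert (Ds : Rabs (D s) <= s * (M * exp (x ^ 2 / 2) + eps) / 2).
  { apply (radial_gradient_bound D (fun y => G y - exp (z0 y)) x); [| exact D0 | | lra].
    - intros y Hy; apply HD; lra.
    - intros y Hy.
      assert (K1 := HGW y ltac:(lra)). assert (K2 := HM y ltac:(lra)).
      assert (K3 := HM' y ltac:(lra)). lra. }
  assert (K : Rabs (D x) <= Rabs (D s) + Rabs (D s - D x)).
  { replace (D x) with (D s + - (D s - D x)) by ring.
    eapply Rle_trans; [apply Rabs_triang |]. rewrite Rabs_Ropp.
    replace (D s + - (D s - D x)) with (D x) by ring. lra. }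
  assert (P := exp_pos (x ^ 2 / 2)).
  assert (Q : s * (M * exp (x ^ 2 / 2) + eps) <= x * (M * exp (x ^ 2 / 2) + eps))
    by (apply Rmult_le_compat_r; [nra | lra]).
  lra. }
assert (Wbound : forall M, (forall x, 0 < x < T -> Rabs (W x) <= M * exp (x ^ 2 / 2)) -> 0 <= M ->
   forall x, 0 < x < T -> Rabs (W x) * exp (- (x ^ 2 / 2)) <= M / 2 + eps * T ^ 2 / 4).
{ intros M HM HM0 x Hx.
  assert (H : Rabs (W x) <= M / 2 * (exp (x ^ 2 / 2) - 1) + eps * x ^ 2 / 4).
  { apply (abs_le_of_derive_abs_le W D (fun y => M / 2 * (exp (y ^ 2 / 2) - 1) + eps * y ^ 2 / 4)
      (fun y => y / 2 * (M * exp (y ^ 2 / 2) + eps)) T); try assumption.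
    - intros y Hy; auto_derive; [exact I | ].
      replace (y * (y * 1) * / 2) with (y ^ 2 / 2) by (simpl; field). field.
    - apply Dbound; assumption.
    - apply continuous_at_right.
      + apply (ex_derive_continuous (K := R_AbsRing) (V := R_NormedModule)).
        auto_derive; exact I.
      + replace (0 ^ 2 / 2) with 0 by field. rewrite exp_0; field. }
  assert (E1 : exp (x ^ 2 / 2) * exp (- (x ^ 2 / 2)) = 1).
  { rewrite <- exp_plus, Rplus_opp_r; apply exp_0. }
  assert (P1 : 0 < exp (- (x ^ 2 / 2))) by apply exp_pos.
  assert (P2 : exp (- (x ^ 2 / 2)) <= 1).
  { rewrite <- exp_0; apply Rlt_le, exp_increasing; nra. }
  apply Rle_trans with ((M / 2 * (exp (x ^ 2 / 2) - 1) + eps * x ^ 2 / 4) * exp (- (x ^ 2 / 2))).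
  { apply Rmult_le_compat_r; lra. }
  replace ((M / 2 * (exp (x ^ 2 / 2) - 1) + eps * x ^ 2 / 4) * exp (- (x ^ 2 / 2)))
    with (M / 2 * (exp (x ^ 2 / 2) * exp (- (x ^ 2 / 2)) - exp (- (x ^ 2 / 2)))
          + eps * x ^ 2 / 4 * exp (- (x ^ 2 / 2))) by ring.
  rewrite E1.
  apply Rplus_le_compat; [nra |].
  assert (0 <= eps * x ^ 2 / 4) by nra.
  apply Rle_trans with (eps * x ^ 2 / 4 * 1); [apply Rmult_le_compat_l; lra |].
  assert (x ^ 2 <= T ^ 2) by nra. nra. }
set (E := fun y => exists x, 0 < x < T /\ y = Rabs (W x) * exp (- (x ^ 2 / 2))).
assert (EW : forall M, is_upper_bound E M ->
   forall x, 0 < x < T -> Rabs (W x) <= M * exp (x ^ 2 / 2)).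
{ intros M HM x Hx.
  assert (K : Rabs (W x) * exp (- (x ^ 2 / 2)) <= M) by (apply HM; exists x; auto).
  replace (Rabs (W x)) with (Rabs (W x) * exp (- (x ^ 2 / 2)) * exp (x ^ 2 / 2)).
  - apply Rmult_le_compat_r; [apply Rlt_le, exp_pos | exact K].
  - rewrite Rmult_assoc, <- exp_plus, Rplus_opp_l, exp_0; ring. }
assert (Eb : bound E).
{ exists (T ^ 2 / 2); intros y [x [Hx ->]].
  assert (K : Rabs (W x) <= T ^ 2 / 2).
  { assert (K1 : Rabs (Z x) <= x ^ 2 / 4) by (apply (radial_lower_bound Z V G T); assumption).
    assert (K2 : Rabs (z0 x) <= x ^ 2 / 4).
    { apply (radial_lower_bound z0 z0' (fun y => exp (z0 y)) T).
      - intros; apply is_derive_z0.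
      - intros y Hy; rewrite <- z0_equation by lra; apply is_derive_z0'.
      - apply z0_at_right.
      - apply z0'_at_right.
      - intros y Hy; split; [apply Rlt_le, exp_pos |].
        rewrite <- exp_0; destruct (z0_nonpos y) as [K | K].
        + apply Rlt_le, exp_increasing, K.
        + rewrite K; apply Rle_refl.
      - exact Hx. }
    unfold W; eapply Rle_trans; [apply Rabs_triang |]; rewrite Rabs_Ropp; nra. }
  assert (P1 : 0 < exp (- (x ^ 2 / 2))) by apply exp_pos.
  assert (P2 : exp (- (x ^ 2 / 2)) <= 1).
  { rewrite <- exp_0; apply Rlt_le, exp_increasing; nra. }
  assert (P3 := Rabs_pos (W x)). nra. }
destruct (completeness E Eb) as [M [Mub Mlub]].
{ eexists; exists (T / 2); split; [lra | reflexivity]. }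
assert (M0 : 0 <= M).
{ apply Rle_trans with (Rabs (W (T / 2)) * exp (- ((T / 2) ^ 2 / 2))).
  - apply Rmult_le_pos; [apply Rabs_pos | apply Rlt_le, exp_pos].
  - apply Mub; exists (T / 2); split; [lra | reflexivity]. }
assert (HM : M <= eps * T ^ 2 / 2).
{ assert (M <= M / 2 + eps * T ^ 2 / 4); [| lra].
  apply Mlub; intros y [x [Hx ->]]; apply Wbound; auto. }
intros x Hx.
assert (P1 : 0 < exp (x ^ 2 / 2)) by apply exp_pos.
assert (P2 : exp (x ^ 2 / 2) < exp (T ^ 2 / 2)) by (apply exp_increasing; nra).
assert (Q : M * exp (x ^ 2 / 2) <= eps * (T ^ 2 / 2 * exp (T ^ 2 / 2))).
{ apply Rle_trans with (eps * T ^ 2 / 2 * exp (T ^ 2 / 2)); [| right; field].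
  apply Rmult_le_compat; lra. }
split.
- apply Rle_trans with (2 := Q), (EW M Mub x Hx).
- apply Rle_trans with (1 := Dbound M (EW M Mub) M0 x Hx).
  replace (eps * (T / 2 * (T ^ 2 / 2 * exp (T ^ 2 / 2) + 1)))
    with (T / 2 * (eps * (T ^ 2 / 2 * exp (T ^ 2 / 2)) + eps)) by ring.
  apply Rmult_le_compat; [lra | | lra | lra].
  nra.
Qed.

(** * Growth of the nonlinearity *)

Lemma is_derive_Rpower (p t : R) : 0 < t ->
  is_derive (fun s => Rpower s p) t (p * Rpower t (p - 1)).
Proof. intros Ht; apply is_derive_Reals, derivable_pt_lim_power, Ht. Qed.

Lemma Rpower_pos (t p : R) : 0 < Rpower t p.
Proof. apply exp_pos. Qed.

Lemma Rpower_pred_mult (t p : R) : 0 < t -> Rpower t (p - 1) * t = Rpower t p.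
Proof.
intros Ht; rewrite <- (Rpower_1 t Ht) at 2; rewrite <- Rpower_plus; f_equal; ring.
Qed.

Lemma Rpower_to_infty (p A : R) : 0 < p ->
  exists m, 0 < m /\ forall t, m <= t -> A <= Rpower t p.
Proof.
intros Hp; exists (exp (Rmax A 0 / p)); split; [apply exp_pos |].
intros t Ht.
assert (H0 : 0 < t) by (eapply Rlt_le_trans; [apply exp_pos | exact Ht]).
assert (Hl : Rmax A 0 / p <= ln t).
{ rewrite <- (ln_exp (Rmax A 0 / p)); apply ln_le; [apply exp_pos | exact Ht]. }
assert (K : Rmax A 0 <= p * ln t).
{ apply Rmult_le_compat_l with (r := p) in Hl; [| lra].
  replace (p * (Rmax A 0 / p)) with (Rmax A 0) in Hl by (field; lra); exact Hl. }
assert (A <= Rmax A 0) by apply Rmax_l.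
unfold Rpower.
assert (KK := exp_ineq1_le (p * ln t)). lra.
Qed.

Lemma Rpower_near_1 (q e : R) : 0 < e ->
  exists d, 0 < d < 1 /\ forall y, 1 - d <= y <= 1 -> Rabs (Rpower y q - 1) <= e.
Proof.
intros He.
assert (C : continuous (fun s => Rpower s q) 1).
{ apply (ex_derive_continuous (K := R_AbsRing) (V := R_NormedModule)).
  eexists; apply is_derive_Rpower; lra. }
destruct (proj1 (filterlim_locally _ _) C (mkposreal _ He)) as [d Hd].
assert (Hd0 := cond_pos d).
assert (J0 : 0 < Rmin (d / 2) (1 / 2)) by (apply Rmin_pos; lra).
assert (J1 := Rmin_l (d / 2) (1 / 2)). assert (J2 := Rmin_r (d / 2) (1 / 2)).
exists (Rmin (d / 2) (1 / 2)); split; [lra |].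
intros y Hy.
assert (K : Rabs (Rpower y q - Rpower 1 q) < e).
{ apply (Hd y). change (Rabs (y - 1) < d). rewrite Rabs_left1; lra. }
replace (Rpower 1 q) with 1 in K; [lra |].
unfold Rpower; rewrite ln_1, Rmult_0_r, exp_0; reflexivity.
Qed.

Lemma rpow_pos_eq (t p : R) : 0 < t -> rpow t p = Rpower t p.
Proof. intros Ht; unfold rpow; destruct (Rlt_dec 0 t); [reflexivity | lra]. Qed.

Lemma rpow_le (t s p : R) : 0 < p -> 0 < s -> t <= s -> rpow t p <= Rpower s p.
Proof.
intros Hp Hs Hts; unfold rpow; destruct (Rlt_dec 0 t).
- apply Rle_Rpower_l; lra.
- apply Rlt_le, Rpower_pos.
Qed.

Lemma C1_Ici_derive (h : R -> R) (t : R) : C1_on (Ici 0) h -> 0 < t ->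
  is_derive h t (Derive_on (Ici 0) h t).
Proof.
intros [H _] Ht.
apply (is_derive_on_interior (Ici 0)); [apply Ici_interior, Ht |].
apply Derive_on_correct; [apply Ici_accumulation; unfold Ici; lra |].
apply H; unfold Ici; lra.
Qed.

Lemma continuous_Rmax_0 (D : R -> Prop) (g : R -> R) (c : R) :
  locally c (fun y => D (Rmax 0 y)) ->
  filterlim g (within D (locally (Rmax 0 c))) (locally (g (Rmax 0 c))) ->
  continuous (fun y => g (Rmax 0 y)) c.
Proof.
intros HD Hg P HP; destruct (Hg P HP) as [d Hd].
assert (Hc : locally c (fun y => Rabs (y - c) < d)) by (exists d; auto).
unfold filtermap; generalize (filter_and _ _ HD Hc); apply filter_imp; intros y [Dy Hy].
apply Hd; [| exact Dy].
change (Rabs (Rmax 0 y - Rmax 0 c) < d); revert Hy.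
unfold Rmax; destruct (Rle_dec 0 y), (Rle_dec 0 c); unfold Rabs;
  repeat destruct Rcase_abs; lra.
Qed.

Lemma C1_Ici_bounded (h : R -> R) (t : R) : C1_on (Ici 0) h -> 0 <= t ->
  exists M, forall s, 0 <= s <= t -> h s <= M.
Proof.
intros [H _] Ht.
destruct (continuity_ab_maj (fun s => h (Rmax 0 s)) 0 t) as [m [Hm _]]; [exact Ht | |].
- intros c Hc; apply continuity_pt_filterlim.
  apply (continuous_Rmax_0 (Ici 0)).
  + apply filter_forall; intros y; apply Rmax_l.
  + destruct (H (Rmax 0 c) (Rmax_l 0 c)) as [l Hl].
    apply is_derive_on_continuous with l; [apply Rmax_l | exact Hl].
- exists (h (Rmax 0 m)); intros s Hs.
  specialize (Hm s Hs); rewrite (Rmax_right 0 s) in Hm; lra.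
Qed.

Section Nonlinearity.
Variables (p : R) (h : R -> R) (t0 : R).
Hypothesis Hp : 0 < p.
Hypothesis Hh : forall t, 0 <= t -> 0 <= h t.
Hypothesis HC : C1_on (Ici 0) h.
Hypothesis Ht0 : 0 < t0.
Hypothesis Hpos : forall t, t0 <= t -> 0 < h t.
Hypothesis Hlim :
  is_lim (fun t => Derive_on (Ici 0) h t / (Rpower t (p - 1) * h t)) p_infty 0.

Let eta (t : R) : R := Derive_on (Ici 0) h t / (Rpower t (p - 1) * h t).
Let phi (t : R) : R := ln (h t) + Rpower t p.

Lemma eta_small (e : R) : 0 < e ->
  exists m, t0 <= m /\ forall t, m <= t -> Rabs (eta t) <= e.
Proof.
intros He.
apply is_lim_spec in Hlim.
destruct (Hlim (mkposreal _ He)) as [m Hm].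
assert (J1 := Rmax_l t0 (m + 1)). assert (J2 := Rmax_r t0 (m + 1)).
exists (Rmax t0 (m + 1)); split; [exact J1 |].
intros t Ht; specialize (Hm t ltac:(lra)); simpl in Hm.
rewrite Rminus_0_r in Hm; apply Rlt_le, Hm.
Qed.

Lemma nonlin_exp (t : R) : t0 <= t -> nonlin p h t = exp (phi t).
Proof.
intros Ht; unfold nonlin, phi; rewrite exp_plus, exp_ln by (apply Hpos, Ht).
rewrite rpow_pos_eq by lra; reflexivity.
Qed.

Lemma nonlin_pos (t : R) : t0 <= t -> 0 < nonlin p h t.
Proof. intros Ht; rewrite nonlin_exp by exact Ht; apply exp_pos. Qed.

Lemma nonlin_nonneg (t : R) : 0 <= t -> 0 <= nonlin p h t.
Proof.
intros Ht; unfold nonlin; apply Rmult_le_pos; [apply Hh, Ht | apply Rlt_le, exp_pos].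
Qed.

Lemma is_derive_log_nonlin (t : R) : t0 <= t ->
  is_derive phi t (Rpower t (p - 1) * (p + eta t)).
Proof.
intros Ht; assert (Hht := Hpos t Ht).
assert (P := Rpower_pos t (p - 1)).
unfold phi; evar_last.
- apply (is_derive_plus (K := R_AbsRing) (V := R_NormedModule)).
  + apply (is_derive_comp ln h t).
    * apply is_derive_Reals, derivable_pt_lim_ln, Hht.
    * apply C1_Ici_derive; [exact HC | lra].
  + apply is_derive_Rpower; lra.
- unfold plus, scal, eta; simpl; unfold mult; simpl; field; split; lra.
Qed.

Lemma log_nonlin_MVT (s t : R) : t0 <= s < t ->
  exists c, s < c < t /\ phi t - phi s = Rpower c (p - 1) * (p + eta c) * (t - s).
Proof.
intros Hst.
destruct (MVT_cor2 phi (fun c => Rpower c (p - 1) * (p + eta c)) s t) as [c [E Hc]].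
- lra.
- intros c Hc; apply is_derive_Reals, is_derive_log_nonlin; lra.
- exists c; split; [exact Hc | exact E].
Qed.

Lemma log_nonlin_growth : exists m, t0 <= m /\ forall s t, m <= s < t ->
  (Rpower t p - Rpower s p) / 2 <= phi t - phi s.
Proof.
destruct (eta_small (p / 2)) as [m [Hm He]]; [lra |].
exists m; split; [exact Hm |]; intros s t Hst.
destruct (MVT_cor2 (fun t => phi t - / 2 * Rpower t p)
  (fun c => Rpower c (p - 1) * (p + eta c) - / 2 * (p * Rpower c (p - 1))) s t) as [c [E Hc]].
- lra.
- intros c Hc; apply is_derive_Reals.
  apply (is_derive_minus (K := R_AbsRing) (V := R_NormedModule)).
  + apply is_derive_log_nonlin; lra.
  + apply is_derive_scal, is_derive_Rpower; lra.
- simpl in E.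
  assert (P := Rpower_pos c (p - 1)).
  assert (K := He c ltac:(lra)); apply Rabs_le_between in K.
  assert (0 <= (Rpower c (p - 1) * (p + eta c) - / 2 * (p * Rpower c (p - 1))) * (t - s)).
  { apply Rmult_le_pos; [| lra].
    replace (Rpower c (p - 1) * (p + eta c) - / 2 * (p * Rpower c (p - 1)))
      with (Rpower c (p - 1) * (p / 2 + eta c)) by field.
    apply Rmult_le_pos; lra. }
  lra.
Qed.

Lemma nonlin_le_of_le : exists m, t0 <= m /\ forall t s, m <= t -> 0 <= s <= t ->
  nonlin p h s <= nonlin p h t.
Proof.
destruct log_nonlin_growth as [m1 [Hm1 Hg]].
destruct (C1_Ici_bounded h m1 HC ltac:(lra)) as [M HM].
set (B := Rabs M * exp (Rpower m1 p)).
assert (HB : forall s, 0 <= s <= m1 -> nonlin p h s <= B).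
{ intros s Hs; unfold nonlin, B; apply Rmult_le_compat.
  - apply Hh; lra.
  - apply Rlt_le, exp_pos.
  - eapply Rle_trans; [apply HM, Hs | apply Rle_abs].
  - assert (K : rpow s p <= Rpower m1 p) by (apply rpow_le; lra).
    destruct K as [K | K]; [apply Rlt_le, exp_increasing, K | rewrite K; apply Rle_refl]. }
destruct (Rpower_to_infty p (2 * (B - phi m1) + Rpower m1 p) Hp) as [m2 [Hm2 HP]].
exists (Rmax (m1 + 1) m2).
assert (J1 := Rmax_l (m1 + 1) m2). assert (J2 := Rmax_r (m1 + 1) m2).
split; [lra |]; intros t s Ht Hs.
destruct (Rle_dec s m1) as [h1 | h1].
- apply Rle_trans with B; [apply HB; lra |].
  rewrite nonlin_exp by lra.
  assert (K := Hg m1 t ltac:(lra)). assert (K' := HP t ltac:(lra)).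
  assert (KK := exp_ineq1_le (phi t)). lra.
- rewrite !nonlin_exp by lra.
  destruct (Req_dec s t) as [-> | E]; [apply Rle_refl |].
  assert (K := Hg s t ltac:(lra)).
  assert (K' : Rpower s p <= Rpower t p) by (apply Rle_Rpower_l; lra).
  assert (K2 : phi s <= phi t) by lra.
  destruct K2 as [K2 | K2]; [apply Rlt_le, exp_increasing, K2 | rewrite K2; apply Rle_refl].
Qed.

Lemma nonlin_ratio (K e : R) : 0 < K -> 0 < e ->
  exists m, t0 <= m /\ forall t z, m <= t -> - K <= z <= 0 ->
    Rabs (nonlin p h (t + z / (p * Rpower t (p - 1))) / nonlin p h t - exp z) <= e.
Proof.
intros HK He.
assert (C : continuous exp 0).
{ apply (ex_derive_continuous (K := R_AbsRing) (V := R_NormedModule)).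
  eexists; apply is_derive_exp. }
destruct (proj1 (filterlim_locally _ _) C (mkposreal _ He)) as [d Hd].
assert (Hd0 := cond_pos d).
assert (Hde : forall a, Rabs a < d -> Rabs (exp a - 1) < e).
{ intros a Ha; rewrite <- exp_0; apply (Hd a).
  change (Rabs (a - 0) < d); rewrite Rminus_0_r; exact Ha. }
(* [delta] controls [(c/t)^(p-1) - 1] and [eta c / p] in the mean value theorem. *)
set (delta := Rmin (d / (4 * K)) 1).
assert (J0 : 0 < delta).
{ apply Rmin_pos; [apply Rdiv_lt_0_compat; lra | lra]. }
assert (J1 : delta <= d / (4 * K)) by apply Rmin_l. assert (J2 : delta <= 1) by apply Rmin_r.
assert (J3 : K * delta <= d / 4).
{ apply Rle_trans with (K * (d / (4 * K))); [apply Rmult_le_compat_l; lra | right; field; lra]. }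
destruct (Rpower_near_1 (p - 1) delta J0) as [r [Hr HR]].
destruct (eta_small (p * delta)) as [m1 [Hm1 Heta]]; [nra |].
destruct (Rpower_to_infty p (K / (p * r)) Hp) as [m2 [Hm2 HP]].
exists (Rmax (m1 / (1 - r)) (Rmax m1 m2)).
assert (L1 := Rmax_l (m1 / (1 - r)) (Rmax m1 m2)).
assert (L2 := Rmax_r (m1 / (1 - r)) (Rmax m1 m2)).
assert (L3 := Rmax_l m1 m2). assert (L4 := Rmax_r m1 m2).
split; [lra |]; intros t z Ht Hz.
assert (Ht_pos : 0 < t) by lra.
set (q := p * Rpower t (p - 1)).
assert (Hq : 0 < q) by (apply Rmult_lt_0_compat; [lra | apply Rpower_pos]).
assert (Hqt : K <= r * (q * t)).
{ unfold q; rewrite Rmult_assoc, Rpower_pred_mult by exact Ht_pos.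
  assert (K0 := HP t ltac:(lra)).
  apply Rmult_le_compat_l with (r := p * r) in K0; [| nra].
  replace (p * r * (K / (p * r))) with K in K0 by (field; lra). lra. }
set (s := t + z / q).
assert (Hqs : q * (s - t) = z) by (unfold s; field; lra).
assert (Hs1 : (1 - r) * t <= s) by nra.
assert (Hs2 : m1 <= s).
{ apply Rle_trans with (2 := Hs1).
  replace m1 with ((1 - r) * (m1 / (1 - r))) by (field; lra).
  apply Rmult_le_compat_l; lra. }
rewrite !nonlin_exp by lra.
destruct (Req_dec z 0) as [Ez | Ez].
{ assert (Es : s = t) by nra. rewrite Es, Ez, exp_0.
  unfold Rdiv; rewrite Rinv_r by (apply Rgt_not_eq, exp_pos).
  rewrite Rminus_diag, Rabs_R0; lra. }
assert (Hst : s < t) by nra.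
destruct (log_nonlin_MVT s t) as [c [Hc E]]; [lra |].
set (A := Rpower (c / t) (p - 1)). set (D := eta c / p).
assert (EA : Rpower c (p - 1) * (p + eta c) * (t - s) = - z * (A * (1 + D))).
{ replace (Rpower c (p - 1)) with (A * Rpower t (p - 1)).
  - rewrite <- Hqs; unfold q, D; field; lra.
  - unfold A; rewrite Rpower_mult_distr.
    2: { apply Rdiv_lt_0_compat; lra. }
    2: exact Ht_pos.
    f_equal; field; lra. }
assert (BA : Rabs (A - 1) <= delta).
{ apply HR; split.
  - apply Rmult_le_reg_r with t; [exact Ht_pos |].
    unfold Rdiv; rewrite Rmult_assoc, Rinv_l by lra; lra.
  - apply Rmult_le_reg_r with t; [exact Ht_pos |].
    unfold Rdiv; rewrite Rmult_assoc, Rinv_l by lra; lra. }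
assert (BD : Rabs D <= delta).
{ unfold D; unfold Rdiv; rewrite Rabs_mult, (Rabs_pos_eq (/ p)) by (apply Rlt_le, Rinv_0_lt_compat, Hp).
  apply Rmult_le_reg_r with p; [exact Hp |].
  rewrite Rmult_assoc, Rinv_l, Rmult_1_r by lra.
  rewrite Rmult_comm; apply Heta; lra. }
assert (BAD : Rabs (A * (1 + D) - 1) <= 3 * delta).
{ replace (A * (1 + D) - 1) with ((A - 1) + D + (A - 1) * D) by ring.
  eapply Rle_trans; [apply Rabs_triang |].
  assert (T := Rabs_triang (A - 1) D).
  rewrite Rabs_mult.
  assert (P1 := Rabs_pos (A - 1)). assert (P2 := Rabs_pos D). nra. }
assert (ES : phi s - phi t - z = z * (A * (1 + D) - 1)) by (rewrite EA in E; lra).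
assert (BS : Rabs (phi s - phi t - z) < d).
{ rewrite ES, Rabs_mult, (Rabs_left1 z) by lra.
  apply Rle_lt_trans with (K * (3 * delta)); [| lra].
  apply Rmult_le_compat; [lra | apply Rabs_pos | lra | exact BAD]. }
replace (exp (phi s) / exp (phi t) - exp z) with (exp z * (exp (phi s - phi t - z) - 1)).
- rewrite Rabs_mult, (Rabs_pos_eq (exp z)) by (apply Rlt_le, exp_pos).
  assert (K1 : exp z <= 1) by (rewrite <- exp_0; apply Rlt_le, exp_increasing; lra).
  assert (K2 := exp_pos z). assert (K3 := Hde _ BS).
  assert (K4 := Rabs_pos (exp (phi s - phi t - z) - 1)). nra.
- unfold Rdiv; rewrite <- exp_Ropp, <- exp_plus, Rmult_minus_distr_l, <- exp_plus, Rmult_1_r.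
  f_equal; f_equal; ring.
Qed.

Lemma continuous_nonlin (t : R) : 0 < t -> continuous (nonlin p h) t.
Proof.
intros Ht.
apply (continuous_ext_loc (nonlin p h) (fun s => h s * exp (Rpower s p)) t).
- exists (mkposreal t Ht); intros s Hs.
  change (Rabs (s - t) < t) in Hs; apply Rabs_def2 in Hs.
  unfold nonlin; rewrite rpow_pos_eq by lra; reflexivity.
- apply (ex_derive_continuous (K := R_AbsRing) (V := R_NormedModule)).
  apply ex_derive_mult.
  + eexists; apply C1_Ici_derive; assumption.
  + apply ex_derive_comp; eexists; [apply is_derive_exp | apply is_derive_Rpower, Ht].
Qed.

End Nonlinearity.

(** * Radial solutions and their rescaling *)

Lemma filterlim_scale_at_right (g : R) : 0 < g ->
  filterlim (fun x => g * x) (at_right 0) (at_right 0).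
Proof.
intros Hg P [d Hd].
assert (Hp : 0 < d / g) by (apply Rdiv_lt_0_compat; [apply cond_pos | exact Hg]).
exists (mkposreal _ Hp); intros x Bx Hx; apply Hd; [| nra].
change (Rabs (x - 0) < d / g) in Bx; change (Rabs (g * x - 0) < d).
rewrite Rminus_0_r in *; rewrite Rabs_mult, Rabs_pos_eq by lra.
apply Rmult_lt_compat_l with (r := g) in Bx; [| exact Hg].
replace (g * (d / g)) with (pos d) in Bx by (field; lra); exact Bx.
Qed.

Section Solution.
Variables (f : R -> R) (lam mu : R) (u : R -> R).
Hypothesis Hsol : is_solution f lam mu u.

Let v : R -> R := Derive_on (Icc 0 1) u.

Lemma solution_derive_on (x : R) : 0 <= x <= 1 -> is_derive_on (Icc 0 1) u x (v x).
Proof.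
destruct Hsol as (_ & _ & [[H _] _] & _); intros Hx.
apply Derive_on_correct; [apply Icc_accumulation; [lra | exact Hx] | apply H, Hx].
Qed.

Lemma solution_derive (x : R) : 0 < x < 1 -> is_derive u x (v x).
Proof.
intros Hx; apply (is_derive_on_interior (Icc 0 1)); [apply Icc_interior, Hx |].
apply solution_derive_on; lra.
Qed.

Lemma solution_derive2 (x : R) : 0 < x < 1 ->
  is_derive v x (- (lam * f (u x)) - v x / x).
Proof.
intros Hx; destruct Hsol as (_ & _ & [_ [H _]] & E & _).
specialize (E x Hx).
replace (- (lam * f (u x)) - v x / x) with (Derive_on (Icc 0 1) v x).
- apply (is_derive_on_interior (Icc 0 1)); [apply Icc_interior, Hx |].
  apply Derive_on_correct; [apply Icc_accumulation; unfold Icc; lra |].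
  apply H; unfold Icc; lra.
- rewrite <- E; unfold v; field; lra.
Qed.

Lemma at_right_Icc : at_right 0 (Icc 0 1).
Proof.
exists (mkposreal 1 Rlt_0_1); intros x Bx Hx.
change (Rabs (x - 0) < 1) in Bx; apply Rabs_def2 in Bx; unfold Icc; lra.
Qed.

Lemma solution_continuous (x : R) : 0 <= x <= 1 ->
  filterlim u (within (Icc 0 1) (locally x)) (locally (u x)).
Proof.
intros Hx; apply is_derive_on_continuous with (v x); [exact Hx | apply solution_derive_on, Hx].
Qed.

Lemma solution_at_right : filterlim u (at_right 0) (locally mu).
Proof.
destruct Hsol as (_ & _ & _ & _ & _ & E & _).
rewrite <- E; apply (within_at_right (Icc 0 1)); [apply at_right_Icc |].
apply solution_continuous; lra.
Qed.

Lemma solution_derive_at_right : filterlim v (at_right 0) (locally 0).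
Proof.
destruct Hsol as (_ & _ & [[_ H] _] & _ & _ & _ & E & _).
apply (within_at_right (Icc 0 1)); [apply at_right_Icc |].
assert (K : filterlim v (within (Icc 0 1) (locally 0)) (locally (v 0))).
{ apply H; unfold Icc; lra. }
unfold v in K at 2; rewrite E in K; exact K.
Qed.

Lemma solution_pos (x : R) : 0 <= x < 1 -> 0 < u x.
Proof.
destruct Hsol as (_ & Hmu & _ & _ & H & E & _); intros Hx.
destruct (Req_dec x 0) as [-> | Hx0]; [lra | apply H; lra].
Qed.

Lemma solution_flux (rho : R) :
  (forall t, 0 < t -> continuous f t) -> 0 < rho < 1 ->
  RInt (fun r => lam * f (u r) * r) 0 rho = - (rho * v rho).
Proof.
intros Hf Hrho.
set (g := fun r => lam * f (u (Rmax 0 r)) * r).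
assert (Hg : forall r, -1 < r < 1 -> continuous g r).
{ intros r Hr; assert (Hr' : 0 <= Rmax 0 r < 1).
  { split; [apply Rmax_l | apply Rmax_lub_lt; lra]. }
  apply (continuous_mult (K := R_AbsRing) (fun r => lam * f (u (Rmax 0 r))) (fun r => r)).
  - apply (continuous_scal_r (K := R_AbsRing) (V := R_NormedModule) lam
      (fun r => f (u (Rmax 0 r)))).
    apply (continuous_comp (fun r => u (Rmax 0 r)) f).
    + apply (continuous_Rmax_0 (Icc 0 1)); [| apply solution_continuous; lra].
      generalize (Icc_interior (-1) 1 r Hr); apply filter_imp.
      intros y Hy; split; [apply Rmax_l | apply Rmax_lub; unfold Icc in Hy; lra].
    + apply Hf, solution_pos; exact Hr'.
  - apply continuous_id. }
assert (Hex : forall r, -1 < r < 1 -> is_RInt g 0 r (RInt g 0 r)).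
{ intros r Hr; apply (RInt_correct (V := R_CompleteNormedModule)).
  apply (ex_RInt_continuous (V := R_CompleteNormedModule)).
  intros y Hy; apply Hg; revert Hy.
  unfold Rmin, Rmax; destruct (Rle_dec 0 r); lra. }
assert (Hd : forall r, -1 < r < 1 -> is_derive (fun r => RInt g 0 r) r (g r)).
{ intros r Hr; apply (is_derive_RInt (V := R_NormedModule) g _ 0 r); [| apply Hg, Hr].
  assert (Hp : 0 < Rmin (r - -1) (1 - r)) by (apply Rmin_pos; lra).
  exists (mkposreal _ Hp); intros y Hy.
  change (Rabs (y - r) < Rmin (r - -1) (1 - r)) in Hy.
  assert (J1 := Rmin_l (r - -1) (1 - r)). assert (J2 := Rmin_r (r - -1) (1 - r)).
  apply Rabs_def2 in Hy; apply Hex; lra. }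
assert (K : Rabs (RInt g 0 rho + rho * v rho) <= 0).
{ apply (abs_le_of_derive_abs_le (fun r => RInt g 0 r + r * v r)
    (fun r => g r + - (r * (lam * f (u r)))) (fun _ => 0) (fun _ => 0) 1); try exact Hrho.
  - intros x Hx; apply (is_derive_plus (K := R_AbsRing) (V := R_NormedModule)).
    + apply Hd; lra.
    + apply (is_derive_radial v (fun x => lam * f (u x))); [lra | apply solution_derive2, Hx].
  - intros x Hx; apply (is_derive_const (K := R_AbsRing) (V := R_NormedModule)).
  - intros x Hx; unfold g; rewrite Rmax_right by lra.
    replace (lam * f (u x) * x + - (x * (lam * f (u x)))) with 0 by ring.
    rewrite Rabs_R0; lra.
  - apply vanish_plus; [| apply vanish_mult_id, solution_derive_at_right].
    apply continuous_at_right; [| apply (RInt_point (V := R_CompleteNormedModule))].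
    apply (ex_derive_continuous (K := R_AbsRing) (V := R_NormedModule)).
    eexists; apply Hd; lra.
  - apply filterlim_const. }
assert (E : RInt (fun r => lam * f (u r) * r) 0 rho = RInt g 0 rho).
{ apply (RInt_ext (V := R_CompleteNormedModule)); intros x Hx.
  rewrite Rmin_left, Rmax_right in Hx by lra.
  unfold g; rewrite Rmax_right by lra; reflexivity. }
rewrite E; assert (K' := Rabs_pos (RInt g 0 rho + rho * v rho)).
assert (K2 : Rabs (RInt g 0 rho + rho * v rho) = 0) by lra.
destruct (Req_dec (RInt g 0 rho + rho * v rho) 0) as [K3 | K3]; [lra |].
apply Rabs_pos_lt in K3; lra.
Qed.

Variables (c g : R).
Hypothesis Hc : 0 < c.
Hypothesis Hg : 0 < g.

Lemma scaled_domain (x : R) : 0 < x < / g -> 0 < g * x < 1.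
Proof.
intros Hx; split; [nra |].
rewrite <- (Rinv_r g) by lra; apply Rmult_lt_compat_l; lra.
Qed.

Lemma scaled_derive (x : R) : 0 < x < / g ->
  is_derive (fun x => c * (u (g * x) - mu)) x (c * g * v (g * x)).
Proof.
intros Hx; assert (Hgx := scaled_domain x Hx).
evar_last.
- apply is_derive_scal.
  apply (is_derive_minus (K := R_AbsRing) (V := R_NormedModule) (fun x => u (g * x)) (fun _ => mu)).
  + apply (is_derive_comp u (fun x => g * x)).
    * apply solution_derive, Hgx.
    * apply is_derive_scal, (is_derive_id (K := R_AbsRing)).
  + apply (is_derive_const (K := R_AbsRing) (V := R_NormedModule)).
- unfold minus, plus, opp, zero, scal, one; simpl; unfold mult; simpl; ring.
Qed.

Lemma scaled_derive2 (x : R) : 0 < x < / g ->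
  is_derive (fun x => c * g * v (g * x)) x
    (- (c * lam * g ^ 2 * f (u (g * x))) - c * g * v (g * x) / x).
Proof.
intros Hx; assert (Hgx := scaled_domain x Hx).
evar_last.
- apply is_derive_scal, (is_derive_comp v (fun x => g * x)).
  + apply solution_derive2, Hgx.
  + apply is_derive_scal, (is_derive_id (K := R_AbsRing)).
- unfold scal, one; simpl; unfold mult; simpl; field; lra.
Qed.

Lemma scaled_at_right : filterlim (fun x => c * (u (g * x) - mu)) (at_right 0) (locally 0).
Proof.
apply (filterlim_comp _ _ _ (fun x => u (g * x)) (fun y => c * (y - mu)) (at_right 0) (locally mu)).
- apply (filterlim_comp _ _ _ (fun x => g * x) u (at_right 0) (at_right 0)).
  + apply filterlim_scale_at_right, Hg.
  + apply solution_at_right.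
- replace 0 with (c * (mu - mu)) by ring.
  apply (ex_derive_continuous (K := R_AbsRing) (V := R_NormedModule) (fun y => c * (y - mu))).
  auto_derive; exact I.
Qed.

Lemma scaled_derive_at_right : filterlim (fun x => c * g * v (g * x)) (at_right 0) (locally 0).
Proof.
apply (filterlim_comp _ _ _ (fun x => v (g * x)) (fun y => c * g * y) (at_right 0) (locally 0)).
- apply (filterlim_comp _ _ _ (fun x => g * x) v (at_right 0) (at_right 0)).
  + apply filterlim_scale_at_right, Hg.
  + apply solution_derive_at_right.
- replace 0 with (c * g * 0) at 2 by ring.
  apply (ex_derive_continuous (K := R_AbsRing) (V := R_NormedModule) (fun y => c * g * y)).
  auto_derive; exact I.
Qed.

Lemma scaled_derive_on (r x : R) : g * r < 1 -> 0 <= x <= r ->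
  is_derive_on (Icc 0 r) (fun x => c * (u (g * x) - mu)) x (c * g * v (g * x)).
Proof.
intros Hr Hx; apply is_derive_on_eps; [exact Hx |]; intros e He.
assert (Hgx : 0 <= g * x <= 1) by nra.
assert (He' : 0 < e / (c * g)) by (apply Rdiv_lt_0_compat; nra).
destruct (proj1 (is_derive_on_eps (Icc 0 1) u (g * x) _ Hgx)
  (solution_derive_on _ Hgx) _ He') as [d Hd].
assert (Hp : 0 < d / g) by (apply Rdiv_lt_0_compat; [apply cond_pos | exact Hg]).
exists (mkposreal _ Hp); simpl; intros y [Hy1 Hy2] By.
assert (Eg : Rabs (g * y - g * x) = g * Rabs (y - x)).
{ rewrite <- Rmult_minus_distr_l, Rabs_mult, Rabs_pos_eq; lra. }
assert (K := Hd (g * y)); rewrite Eg in K.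
replace (c * (u (g * y) - mu) - c * (u (g * x) - mu) - (y - x) * (c * g * v (g * x)))
  with (c * (u (g * y) - u (g * x) - (g * y - g * x) * v (g * x))) by ring.
rewrite Rabs_mult, (Rabs_pos_eq c) by lra.
replace (e * Rabs (y - x)) with (c * (e / (c * g) * (g * Rabs (y - x)))) by (field; lra).
apply Rmult_le_compat_l; [lra |]; apply K.
- split; nra.
- apply Rmult_lt_compat_l with (r := g) in By; [| exact Hg].
  replace (g * (d / g)) with (pos d) in By by (field; lra); exact By.
Qed.

End Solution.

(** * Convergence of the rescaled solutions *)

Definition rescaled' (p mu gam : R) (u : R -> R) (r : R) : R :=
  p * Rpower mu (p - 1) * gam * Derive_on (Icc 0 1) u (gam * r).

Section Rescaled.
Variables (p : R) (h : R -> R).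
Hypothesis Hp : 0 < p.
Hypothesis Hh : forall t, 0 <= t -> 0 <= h t.
Variables (lam mu gam : R) (u : R -> R).
Hypothesis Hsol : is_solution (nonlin p h) lam mu u.
Hypothesis Hfmu : 0 < nonlin p h mu.
Hypothesis Hmono : forall s, 0 <= s <= mu -> nonlin p h s <= nonlin p h mu.
Hypothesis Hgam : 0 < gam.
Hypothesis Hnorm : p * lam * Rpower mu (p - 1) * nonlin p h mu * gam ^ 2 = 1.

Let c : R := p * Rpower mu (p - 1).
Let Z : R -> R := rescaled p mu gam u.
Let V : R -> R := rescaled' p mu gam u.
Let G (x : R) : R := nonlin p h (u (gam * x)) / nonlin p h mu.

Lemma slope_pos : 0 < p * Rpower mu (p - 1).
Proof. apply Rmult_lt_0_compat; [exact Hp | apply Rpower_pos]. Qed.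

Lemma rescaled_derive (x : R) : 0 < x < / gam -> is_derive Z x (V x).
Proof. intros Hx; eapply (scaled_derive _ _ _ _ Hsol c gam); eassumption. Qed.

Lemma rescaled_derive2 (x : R) : 0 < x < / gam -> is_derive V x (- G x - V x / x).
Proof.
intros Hx; replace (- G x - V x / x)
  with (- (c * lam * gam ^ 2 * nonlin p h (u (gam * x))) - V x / x).
- eapply (scaled_derive2 _ _ _ _ Hsol c gam); eassumption.
- do 2 f_equal; unfold G.
  apply Rmult_eq_reg_r with (nonlin p h mu); [| lra].
  unfold Rdiv; rewrite (Rmult_assoc _ (/ _)), Rinv_l, Rmult_1_r by lra.
  rewrite <- (Rmult_1_l (nonlin p h (u (gam * x)))) at 2.
  rewrite <- Hnorm; unfold c; ring.
Qed.

Lemma rescaled_at_right : filterlim Z (at_right 0) (locally 0).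
Proof. eapply (scaled_at_right _ _ _ _ Hsol c gam); eassumption. Qed.

Lemma rescaled_derive_at_right : filterlim V (at_right 0) (locally 0).
Proof. eapply (scaled_derive_at_right _ _ _ _ Hsol c gam); eassumption. Qed.

Lemma rescaled_nonpos (x : R) : 0 < x < / gam -> Z x <= 0.
Proof.
apply (radial_nonpos Z V G (/ gam)).
- apply rescaled_derive.
- apply rescaled_derive2.
- apply rescaled_at_right.
- apply rescaled_derive_at_right.
- intros y Hy; unfold G; apply Rmult_le_pos; [| apply Rlt_le, Rinv_0_lt_compat, Hfmu].
  apply nonlin_nonneg; [exact Hh |].
  apply Rlt_le, (solution_pos _ _ _ _ Hsol).
  assert (K := scaled_domain gam Hgam y Hy); lra.
Qed.

Lemma rescaled_source (x : R) : 0 < x < / gam -> 0 <= G x <= 1.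
Proof.
intros Hx; assert (K := scaled_domain gam Hgam x Hx).
assert (Hu := solution_pos _ _ _ _ Hsol (gam * x) ltac:(lra)).
assert (HZ := rescaled_nonpos x Hx).
assert (Hc := slope_pos).
assert (Hle : u (gam * x) <= mu) by (unfold Z, rescaled in HZ; nra).
assert (Hi := Rinv_0_lt_compat _ Hfmu).
split; unfold G.
- apply Rmult_le_pos; [apply nonlin_nonneg; [exact Hh | lra] | lra].
- rewrite <- (Rinv_r (nonlin p h mu)) by lra.
  apply Rmult_le_compat_r; [lra | apply Hmono; lra].
Qed.

Lemma rescaled_lower_bound (x : R) : 0 < x < / gam -> Rabs (Z x) <= x ^ 2 / 4.
Proof.
apply (radial_lower_bound Z V G (/ gam)).
- apply rescaled_derive.
- apply rescaled_derive2.
- apply rescaled_at_right.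
- apply rescaled_derive_at_right.
- apply rescaled_source.
Qed.

(* As [x -> 1 / gam] the lower bound meets the boundary condition [u 1 = 0]. *)
Lemma gamma_sqr_bound : 4 * (p * Rpower mu p) * gam ^ 2 <= 1.
Proof.
destruct Hsol as (_ & Hmu & _ & _ & _ & _ & _ & E1).
rewrite <- (Rpower_pred_mult mu p Hmu).
assert (Hc := slope_pos). fold c in Hc.
assert (Hi := Rinv_0_lt_compat _ Hgam).
assert (K : c * mu <= (/ gam) ^ 2 / 4).
{ apply le_epsilon; intros e He.
  assert (Hec : 0 < e / c) by (apply Rdiv_lt_0_compat; lra).
  destruct (proj1 (filterlim_locally (F := within (Icc 0 1) (locally 1)) u (u 1))
    (solution_continuous _ _ _ _ Hsol 1 ltac:(lra)) (mkposreal _ Hec)) as [d Hd].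
  set (x := Rmax (1 / 2) (1 - d / 2)). assert (Hd0 := cond_pos d).
  assert (J1 : 1 / 2 <= x) by apply Rmax_l. assert (J2 : 1 - d / 2 <= x) by apply Rmax_r.
  assert (J3 : x < 1) by (apply Rmax_lub_lt; lra).
  assert (Bx : Rabs (u x - u 1) < e / c).
  { apply (Hd x); [| unfold Icc; lra]. change (Rabs (x - 1) < d); rewrite Rabs_left; lra. }
  rewrite E1, Rminus_0_r in Bx.
  assert (Dx : 0 < / gam * x < / gam) by nra.
  assert (L := rescaled_lower_bound _ Dx).
  unfold Z, rescaled in L. fold c in L.
  replace (gam * (/ gam * x)) with x in L by (field; lra).
  apply Rabs_le_between in L. apply Rabs_def2 in Bx.
  assert (L2 : (/ gam * x) ^ 2 <= (/ gam) ^ 2) by nra.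
  assert (L3 : c * u x <= e).
  { apply Rle_trans with (c * (e / c)); [apply Rmult_le_compat_l; lra | right; field; lra]. }
  nra. }
apply Rmult_le_compat_r with (r := 4 * gam ^ 2) in K; [| nra].
replace ((/ gam) ^ 2 / 4 * (4 * gam ^ 2)) with 1 in K by (field; lra).
unfold c in K; lra.
Qed.

Lemma rescaled_close (R0 eps1 : R) : 0 < R0 -> 0 <= eps1 -> gam * (R0 + 1) < 1 ->
  (forall z, - (R0 + 1) ^ 2 <= z <= 0 ->
    Rabs (nonlin p h (mu + z / (p * Rpower mu (p - 1))) / nonlin p h mu - exp z) <= eps1) ->
  forall x, 0 <= x <= R0 ->
    Rabs (Z x - z0 x) <= eps1 * ((R0 + 1) ^ 2 / 2 * exp ((R0 + 1) ^ 2 / 2)) /\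
    Rabs (V x - z0' x) <=
      eps1 * ((R0 + 1) / 2 * ((R0 + 1) ^ 2 / 2 * exp ((R0 + 1) ^ 2 / 2) + 1)) /\
    Rabs (G x - exp (z0 x)) <=
      eps1 * ((R0 + 1) ^ 2 / 2 * exp ((R0 + 1) ^ 2 / 2) + 1) /\
    Rabs (Z x) <= x ^ 2 / 4.
Proof.
intros HR Heps HgR Hratio.
assert (Hc := slope_pos).
set (T := R0 + 1). fold T in HgR, Hratio.
assert (HT : T < / gam).
{ apply Rmult_lt_reg_l with gam; [exact Hgam |]; rewrite Rinv_r by lra; exact HgR. }
assert (Hsub : forall x, 0 < x < T -> 0 < x < / gam) by (intros; unfold T in *; lra).
assert (HGZ : forall x, 0 < x < T -> Rabs (G x - exp (Z x)) <= eps1).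
{ intros x Hx.
  assert (L := rescaled_lower_bound x (Hsub x Hx)).
  assert (N := rescaled_nonpos x (Hsub x Hx)).
  apply Rabs_le_between in L.
  assert (Hx2 : x ^ 2 <= T ^ 2) by (apply pow_incr; lra).
  assert (0 <= x ^ 2) by nra.
  assert (Hz : - T ^ 2 <= Z x <= 0) by lra.
  replace (G x) with (nonlin p h (mu + Z x / (p * Rpower mu (p - 1))) / nonlin p h mu).
  - apply Hratio, Hz.
  - unfold G; do 2 f_equal; unfold Z, rescaled; field.
      split; [apply Rgt_not_eq, Rpower_pos | lra]. }
assert (E : forall a, 0 <= eps1 * (T ^ 2 / 2 * exp a)).
{ intros a; assert (K := exp_pos a); apply Rmult_le_pos; [exact Heps |].
  apply Rmult_le_pos; nra. }
assert (E2 := E (T ^ 2 / 2)).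
intros x Hx.
destruct (Req_dec x 0) as [-> | Hx0].
- destruct Hsol as (_ & _ & _ & _ & _ & E0 & E0' & _).
  assert (Z00 : Z 0 = 0).
  { unfold Z, rescaled; rewrite Rmult_0_r, E0; ring. }
  assert (V00 : V 0 = 0).
  { unfold V, rescaled'; rewrite Rmult_0_r, E0'; ring. }
  assert (G00 : G 0 = 1).
  { unfold G; rewrite Rmult_0_r, E0; field; lra. }
  assert (z00 : z0' 0 = 0) by (unfold z0'; field).
  rewrite Z00, V00, G00, z00, z0_0, exp_0, !Rminus_diag, Rabs_R0.
  repeat split; try lra.
  + assert (0 < T) by (unfold T; lra).
    replace (eps1 * (T / 2 * (T ^ 2 / 2 * exp (T ^ 2 / 2) + 1)))
      with (T / 2 * (eps1 * (T ^ 2 / 2 * exp (T ^ 2 / 2)) + eps1)) by ring.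
    apply Rmult_le_pos; lra.
- assert (HxT : 0 < x < T) by (unfold T; lra).
  destruct (radial_stability Z V G T eps1) with x as [B1 B2].
  + unfold T; lra.
  + exact Heps.
  + intros y Hy; apply rescaled_derive, Hsub, Hy.
  + intros y Hy; apply rescaled_derive2, Hsub, Hy.
  + apply rescaled_at_right.
  + apply rescaled_derive_at_right.
  + intros y Hy; apply rescaled_source, Hsub, Hy.
  + exact HGZ.
  + exact HxT.
  + split; [exact B1 | split; [exact B2 | split]].
    * replace (G x - exp (z0 x)) with ((exp (Z x) - exp (z0 x)) + (G x - exp (Z x))) by ring.
      eapply Rle_trans; [apply Rabs_triang |].
      assert (B3 := exp_lipschitz_nonpos (Z x) (z0 x) (rescaled_nonpos x (Hsub x HxT)) (z0_nonpos x)).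
      assert (B4 := HGZ x HxT). lra.
    * apply rescaled_lower_bound, Hsub, HxT.
Qed.

End Rescaled.

Lemma rescaled_convergence (p : R) (h : R -> R) (t0 : R) :
  0 < p -> (forall t, 0 <= t -> 0 <= h t) -> C1_on (Ici 0) h ->
  0 < t0 -> (forall t, t0 <= t -> 0 < h t) ->
  is_lim (fun t => Derive_on (Ici 0) h t / (Rpower t (p - 1) * h t)) p_infty 0 ->
  forall R0 eps, 0 < R0 -> 0 < eps ->
  exists m, t0 <= m /\ forall lam mu gam u, m <= mu ->
    is_solution (nonlin p h) lam mu u -> 0 < gam ->
    p * lam * Rpower mu (p - 1) * nonlin p h mu * gam ^ 2 = 1 ->
    gam < eps /\ gam * R0 < 1 /\
    forall x, 0 <= x <= R0 ->
      Rabs (rescaled p mu gam u x - z0 x) <= eps /\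
      Rabs (rescaled' p mu gam u x - z0' x) <= eps /\
      Rabs (nonlin p h (u (gam * x)) / nonlin p h mu - exp (z0 x)) <= eps /\
      Rabs (u (gam * x) / mu - 1) <= eps.
Proof.
intros Hp Hh HC Ht0 Hpos Hlim R0 eps HR Heps.
set (T := R0 + 1). assert (HT : 1 < T) by (unfold T; lra).
set (C := T * (T ^ 2 / 2 * exp (T ^ 2 / 2) + 1)).
assert (HC1 : 0 < T ^ 2 / 2 * exp (T ^ 2 / 2)).
{ apply Rmult_lt_0_compat; [nra | apply exp_pos]. }
assert (HC2 : T ^ 2 / 2 * exp (T ^ 2 / 2) + 1 <= C) by (unfold C; nra).
assert (He1 : 0 < eps / C) by (apply Rdiv_lt_0_compat; lra).
assert (EC : eps / C * C = eps) by (field; lra).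
destruct (nonlin_le_of_le p h t0) as [m1 [Hm1 Hmono]]; try assumption.
destruct (nonlin_ratio p h t0 Hp HC Ht0 Hpos Hlim (T ^ 2) (eps / C)) as [m2 [Hm2 Hratio]];
  [nra | exact He1 |].
destruct (Rpower_to_infty p (T ^ 2 / p) Hp) as [m3 [Hm3 HP3]].
destruct (Rpower_to_infty p (/ (p * eps ^ 2)) Hp) as [m4 [Hm4 HP4]].
destruct (Rpower_to_infty p (T ^ 2 / (p * eps)) Hp) as [m5 [Hm5 HP5]].
exists (Rmax m1 (Rmax m2 (Rmax m3 (Rmax m4 m5)))).
assert (L1 := Rmax_l m1 (Rmax m2 (Rmax m3 (Rmax m4 m5)))).
assert (L2 := Rmax_r m1 (Rmax m2 (Rmax m3 (Rmax m4 m5)))).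
assert (L3 := Rmax_l m2 (Rmax m3 (Rmax m4 m5))).
assert (L4 := Rmax_r m2 (Rmax m3 (Rmax m4 m5))).
assert (L5 := Rmax_l m3 (Rmax m4 m5)). assert (L6 := Rmax_r m3 (Rmax m4 m5)).
assert (L7 := Rmax_l m4 m5). assert (L8 := Rmax_r m4 m5).
split; [lra |]; intros lam mu gam u Hmu Hsol Hgam Hnorm.
assert (Hmu0 : 0 < mu) by lra.
assert (Hfmu : 0 < nonlin p h mu) by (apply (nonlin_pos p h t0); [| | lra]; assumption).
assert (Hmono' : forall s, 0 <= s <= mu -> nonlin p h s <= nonlin p h mu).
{ intros s Hs; apply Hmono; [lra | exact Hs]. }
assert (Hgb := gamma_sqr_bound p h Hp Hh lam mu gam u Hsol Hfmu Hmono' Hgam Hnorm).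
assert (Hgam_lt : forall a, 0 < a -> / (p * a ^ 2) <= Rpower mu p -> gam < a).
{ intros a Ha Hle.
  assert (Hpa : 0 < p * a ^ 2) by (apply Rmult_lt_0_compat; [lra | nra]).
  apply Rmult_le_compat_l with (r := p * a ^ 2) in Hle; [| lra].
  rewrite Rinv_r in Hle by lra.
  destruct (Rlt_dec gam a) as [K | K]; [exact K | exfalso].
  assert (P := Rpower_pos mu p).
  assert (a ^ 2 <= gam ^ 2) by nra.
  assert (p * Rpower mu p * a ^ 2 <= p * Rpower mu p * gam ^ 2)
    by (apply Rmult_le_compat_l; nra).
  lra. }
assert (Hg1 : gam < eps) by (apply Hgam_lt; [exact Heps | apply HP4; lra]).
assert (Hg2 : gam * T < 1).
{ assert (K : gam < / T).
  { apply Hgam_lt; [apply Rinv_0_lt_compat; lra |].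
    replace (/ (p * (/ T) ^ 2)) with (T ^ 2 / p) by (field; lra). apply HP3; lra. }
  apply Rmult_lt_compat_r with (r := T) in K; [| lra].
  rewrite Rinv_l in K by lra; exact K. }
split; [exact Hg1 | split; [unfold T in Hg2; nra |]].
intros x Hx.
destruct (rescaled_close p h Hp Hh lam mu gam u Hsol Hfmu Hmono' Hgam Hnorm R0 (eps / C))
  with x as [B1 [B2 [B3 B4]]].
- exact HR.
- lra.
- exact Hg2.
- intros z Hz; apply Hratio; [lra | exact Hz].
- exact Hx.
- fold T in B1, B2, B3. split; [| split; [| split]].
  + apply Rle_trans with (1 := B1). rewrite <- EC at 2. apply Rmult_le_compat_l; lra.
  + apply Rle_trans with (1 := B2). rewrite <- EC at 2. apply Rmult_le_compat_l; [lra |].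
    unfold C; apply Rmult_le_compat_r; lra.
  + apply Rle_trans with (1 := B3). rewrite <- EC at 2. apply Rmult_le_compat_l; lra.
  + assert (P := Rpower_pos mu p).
    assert (K := HP5 mu ltac:(lra)).
    assert (Kp : 0 < p * eps) by (apply Rmult_lt_0_compat; lra).
    apply Rmult_le_compat_l with (r := p * eps) in K; [| lra].
    replace (p * eps * (T ^ 2 / (p * eps))) with (T ^ 2) in K by (field; lra).
    assert (Q : 0 < p * Rpower mu p) by (apply Rmult_lt_0_compat; lra).
    apply Rmult_le_reg_l with (p * Rpower mu p); [exact Q |].
    rewrite <- (Rabs_pos_eq (p * Rpower mu p)) at 1 by lra.
    rewrite <- Rabs_mult.
    replace (p * Rpower mu p * (u (gam * x) / mu - 1)) with (rescaled p mu gam u x).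
    * assert (x ^ 2 <= T ^ 2) by (unfold T; nra). nra.
    * unfold rescaled; rewrite <- (Rpower_pred_mult mu p Hmu0); field; lra.
Qed.

Lemma C1_on_is_derive (D : R -> Prop) (g dg : R -> R) :
  (forall x, D x -> forall e : posreal, exists y, D y /\ y <> x /\ Rabs (y - x) < e) ->
  (forall x, is_derive g x (dg x)) -> (forall x, continuous dg x) -> C1_on D g.
Proof.
intros Hacc Hd Hc; split.
- intros x Dx; exists (dg x); apply is_derive_is_derive_on; auto.
- assert (E : forall x, D x -> Derive_on D g x = dg x).
  { intros x Dx; apply is_derive_on_unique; [auto |].
    apply is_derive_is_derive_on; auto. }
  intros x Dx; rewrite (E x Dx).
  apply filterlim_within_ext with dg; [intros y Dy; rewrite E; auto |].
  apply filterlim_filter_le_1 with (2 := Hc x), filter_le_within.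
Qed.

Lemma C1_on_ext (D : R -> Prop) (g k : R -> R) :
  (forall x, D x -> forall e : posreal, exists y, D y /\ y <> x /\ Rabs (y - x) < e) ->
  (forall x, D x -> g x = k x) -> C1_on D k -> C1_on D g.
Proof.
intros Hacc E [H1 H2].
assert (Hd : forall x, D x -> is_derive_on D g x (Derive_on D k x)).
{ intros x Dx; assert (H := Derive_on_correct D k x (Hacc x Dx) (H1 x Dx)).
  rewrite is_derive_on_eps in H |- * by exact Dx.
  intros e He; destruct (H e He) as [d Hd]; exists d; intros y Dy By.
  rewrite !E by assumption; apply Hd; assumption. }
assert (Ed : forall x, D x -> Derive_on D g x = Derive_on D k x).
{ intros x Dx; apply is_derive_on_unique; auto. }
split.
- intros x Dx; eexists; apply Hd, Dx.
- intros x Dx; rewrite (Ed x Dx).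
  apply filterlim_within_ext with (Derive_on D k); [| apply H2, Dx].
  intros y Dy; rewrite Ed; auto.
Qed.

Lemma Derive_on_z0 (r : R) : Ici 0 r -> Derive_on (Ici 0) z0 r = z0' r.
Proof.
intros Hr; apply is_derive_on_unique; [apply Ici_accumulation, Hr |].
apply is_derive_is_derive_on; [exact Hr | apply is_derive_z0].
Qed.

Lemma Derive_on_Derive_on_z0 (r : R) : 0 < r ->
  Derive_on (Ici 0) (Derive_on (Ici 0) z0) r = z0'' r.
Proof.
intros Hr; apply is_derive_on_unique; [apply Ici_accumulation; unfold Ici; lra |].
apply is_derive_on_interior; [apply Ici_interior, Hr |].
apply (is_derive_ext_loc z0'); [| apply is_derive_z0'].
generalize (Ici_interior 0 r Hr); apply filter_imp; intros y Hy.
rewrite Derive_on_z0; auto.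
Qed.

Lemma z0_C2 : C2_on (Ici 0) z0.
Proof.
split.
- apply (C1_on_is_derive (Ici 0) z0 z0').
  + apply Ici_accumulation.
  + apply is_derive_z0.
  + intros x; apply (ex_derive_continuous (K := R_AbsRing) (V := R_NormedModule)).
    eexists; apply is_derive_z0'.
- apply (C1_on_ext (Ici 0) _ z0' (Ici_accumulation 0) Derive_on_z0).
  apply (C1_on_is_derive (Ici 0) z0' z0'').
  + apply Ici_accumulation.
  + apply is_derive_z0'.
  + intros x; apply (ex_derive_continuous (K := R_AbsRing) (V := R_NormedModule)).
    assert (K := denominator_pos x); unfold z0''; auto_derive; nra.
Qed.

Lemma z0_mass :
  is_RInt_gen (fun r => exp (z0 r) * r) (at_point 0) (Rbar_locally p_infty) 4.
Proof.
set (F := fun r : R => 4 - 32 / (8 + r ^ 2)).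
assert (HF : forall r, is_derive F r (exp (z0 r) * r)).
{ intros r; rewrite exp_z0; assert (K := denominator_pos r).
  unfold F; auto_derive; [nra | field; lra]. }
intros P [e He].
apply (Filter_prod _ _ _ (fun a => a = 0) (fun b => Rabs (F b - 4) < e)).
- reflexivity.
- assert (H0 := cond_pos e).
  exists (32 / e + 1); intros x Hx.
  assert (K : 0 < 32 / e) by (apply Rdiv_lt_0_compat; lra).
  unfold F; replace (4 - 32 / (8 + x ^ 2) - 4) with (- (32 / (8 + x ^ 2))) by ring.
  rewrite Rabs_Ropp, Rabs_pos_eq.
  2: { apply Rlt_le, Rdiv_lt_0_compat; [lra | apply denominator_pos]. }
  assert (D := denominator_pos x).
  apply Rmult_lt_reg_r with (8 + x ^ 2); [exact D |].
  unfold Rdiv; rewrite Rmult_assoc, Rinv_l by lra.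
  assert (E : 32 / e * e = 32) by (field; lra).
  nra.
- intros a b -> Hb; exists (F b); split; [| apply He, Hb]; simpl.
  replace (F b) with (minus (F b) (F 0)).
  2: { unfold minus, plus, opp; simpl; unfold F; field; assert (K := denominator_pos b); lra. }
  apply (is_RInt_derive (V := R_CompleteNormedModule) F); [intros; apply HF |].
  intros x _; apply (ex_derive_continuous (K := R_AbsRing) (V := R_NormedModule)).
  apply ex_derive_mult; [| apply ex_derive_id].
  apply ex_derive_comp; eexists; [apply is_derive_exp | apply is_derive_z0].
Qed.

Lemma sup_norm_le (D : R -> Prop) (g : R -> R) (M : R) :
  (forall x, D x -> Rabs (g x) <= M) -> Rbar_le (sup_norm D g) M.
Proof.
intros H; apply (proj2 (Lub_Rbar_correct (fun y => exists x, D x /\ y = Rabs (g x))) M); intros y [x [Dx ->]]; apply H, Dx.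
Qed.

Lemma diagonal_subsequence (P : nat -> nat -> Prop) :
  (forall k, eventually (P k)) ->
  exists phi : nat -> nat, (forall n, (phi n < phi (S n))%nat) /\ forall k, P k (phi k).
Proof.
intros H.
set (N := fun k => proj1_sig (constructive_indefinite_description _ (H k))).
assert (HN : forall k n, (N k <= n)%nat -> P k n).
{ intros k; unfold N; apply proj2_sig. }
set (phi := fix phi k := match k with O => N O | S j => Nat.max (S (phi j)) (N (S j)) end).
assert (HS : forall j, phi (S j) = Nat.max (S (phi j)) (N (S j))) by reflexivity.
exists phi; split.
- intros n; rewrite HS; lia.
- intros [| k]; apply HN; [apply Nat.le_refl | rewrite HS; lia].
Qed.

Lemma is_lim_seq_INR_plus (a : R) : is_lim_seq (fun k => INR k + a) p_infty.
Proof.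
apply (is_lim_seq_plus _ _ p_infty a p_infty).
- apply is_lim_seq_INR.
- apply is_lim_seq_const.
- reflexivity.
Qed.

Lemma is_lim_seq_of_abs_le (a : nat -> R) (l C : R) :
  (forall k, Rabs (a k - l) <= C / (INR k + 4)) -> is_lim_seq a l.
Proof.
intros H.
assert (L : is_lim_seq (fun k => C / (INR k + 4)) 0).
{ unfold Rdiv; replace 0 with (C * 0) by ring.
  apply (is_lim_seq_scal_l _ C 0).
  apply (is_lim_seq_inv _ p_infty); [apply is_lim_seq_INR_plus | discriminate]. }
apply is_lim_seq_le_le with (fun k => l - C / (INR k + 4)) (fun k => l + C / (INR k + 4)).
- intros k; specialize (H k); apply Rabs_le_between in H; lra.
- replace (Finite l) with (Finite (l - 0)) by (f_equal; ring).
  apply is_lim_seq_minus'; [apply is_lim_seq_const | exact L].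
- replace (Finite l) with (Finite (l + 0)) by (f_equal; ring).
  apply is_lim_seq_plus'; [apply is_lim_seq_const | exact L].
Qed.

Lemma is_derive_on_minus (D : R -> Prop) (g k : R -> R) (x dg dk : R) :
  is_derive_on D g x dg -> is_derive_on D k x dk ->
  is_derive_on D (fun y => g y - k y) x (dg - dk).
Proof.
intros Hg Hk.
assert (H : filterdiff (fun y => minus (g y) (k y)) (within D (locally x))
  (fun y => minus (scal y dg) (scal y dk))).
{ exact (filterdiff_minus_fct (F := within D (locally x)) g k
    (fun y => scal y dg) (fun y => scal y dk) Hg Hk). }
apply (filterdiff_ext_lin _ _ _ H).
intros y; unfold minus, plus, opp, scal; simpl; unfold mult; simpl; ring.
Qed.

Lemma INR_plus_4_pos (k : nat) : 4 <= INR k + 4.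
Proof. assert (H := pos_INR k); lra. Qed.

Theorem theorem1p1 :
  forall (p : R) (h : R -> R) (lam mu : nat -> R) (u : nat -> R -> R)
         (gam : nat -> R),
  0 < p ->
  (forall t, 0 <= t -> 0 <= h t) ->
  C1_on (Ici 0) h ->
  (exists t0, 0 < t0 /\ forall t, t0 <= t -> 0 < h t) ->
  is_lim (fun t => Derive_on (Ici 0) h t / (Rpower t (p - 1) * h t)) p_infty 0 ->
  (forall n, is_solution (nonlin p h) (lam n) (mu n) (u n)) ->
  is_lim_seq mu p_infty ->
  (forall n, 0 < nonlin p h (mu n) ->
     0 < gam n /\
     p * lam n * Rpower (mu n) (p - 1) * nonlin p h (mu n) * gam n ^ 2 = 1) ->
  (C2_on (Ici 0) z0 /\
   (forall r, 0 < r ->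
      - Derive_on (Ici 0) (Derive_on (Ici 0) z0) r
      - / r * Derive_on (Ici 0) z0 r = exp (z0 r)) /\
   z0 0 = 0 /\ Derive_on (Ici 0) z0 0 = 0) /\
  is_RInt_gen (fun r => exp (z0 r) * r) (at_point 0) (Rbar_locally p_infty) 4 /\
  exists phi : nat -> nat,
    (forall n, (phi n < phi (S n))%nat) /\
    exists rho : nat -> R,
      (forall n, 0 < rho n < 1) /\
      is_lim_seq (fun n => gam (phi n)) 0 /\
      is_lim_seq rho 0 /\
      is_lim_seq (fun n => rho n / gam (phi n)) p_infty /\
      is_lim_seq (fun n => u (phi n) (rho n) / mu (phi n)) 1 /\
      (forall eps : posreal, eventually (fun n =>
         Rbar_lt
           (C1_norm (Icc 0 (rho n / gam (phi n)))
              (fun r => rescaled p (mu (phi n)) (gam (phi n)) (u (phi n)) r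
                        - z0 r))
           eps)) /\
      is_lim_seq (fun n =>
         p * Rpower (mu (phi n)) (p - 1) *
         RInt (fun r => lam (phi n) * nonlin p h (u (phi n) r) * r) 0 (rho n)) 4 /\
      exists r0 : nat -> R,
        (forall n, 0 < r0 n < rho n) /\
        is_lim_seq (fun n => r0 n / gam (phi n)) (2 * sqrt 2) /\
        is_lim_seq (fun n => u (phi n) (r0 n) / mu (phi n)) 1 /\
        is_lim_seq (fun n =>
           p * lam (phi n) * r0 n ^ 2 * Rpower (u (phi n) (r0 n)) (p - 1) *
           nonlin p h (u (phi n) (r0 n))) 2.
Proof.
intros p h lam mu u gam Hp Hh HC [t0 [Ht0 Hpos]] Hlim Hsol Hmu Hgam.
split; [| split; [apply z0_mass |]].
{ split; [apply z0_C2 | split; [| split; [apply z0_0 |]]].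
  - intros r Hr; rewrite Derive_on_Derive_on_z0 by exact Hr.
    rewrite Derive_on_z0 by (unfold Ici; lra).
    rewrite z0_equation by exact Hr; field; lra.
  - rewrite Derive_on_z0 by (unfold Ici; lra); unfold z0'; field. }
pose (R0 := fun k => INR k + 4).
pose (P := fun k n =>
  0 < mu n /\ 0 < nonlin p h (mu n) /\
  gam n < / R0 k ^ 2 /\ gam n * R0 k < 1 /\
  forall x, 0 <= x <= R0 k ->
    Rabs (rescaled p (mu n) (gam n) (u n) x - z0 x) <= / R0 k ^ 2 /\
    Rabs (rescaled' p (mu n) (gam n) (u n) x - z0' x) <= / R0 k ^ 2 /\
    Rabs (nonlin p h (u n (gam n * x)) / nonlin p h (mu n) - exp (z0 x)) <= / R0 k ^ 2 /\
    Rabs (u n (gam n * x) / mu n - 1) <= / R0 k ^ 2).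
assert (HR : forall k, 4 <= R0 k) by (intros k; apply INR_plus_4_pos).
destruct (diagonal_subsequence P) as [phi [Hphi HP]].
{ intros k; assert (K := HR k).
  destruct (rescaled_convergence p h t0 Hp Hh HC Ht0 Hpos Hlim (R0 k) (/ R0 k ^ 2))
    as [m [Hm Hconv]]; [lra | apply Rinv_0_lt_compat; nra |].
  apply is_lim_seq_spec in Hmu; destruct (Hmu m) as [N HN].
  exists N; intros n Hn; specialize (HN n Hn).
  assert (Hf : 0 < nonlin p h (mu n)) by (apply (nonlin_pos p h t0); [| | lra]; assumption).
  destruct (Hgam n Hf) as [Hg Hnorm].
  split; [lra | split; [exact Hf |]].
  apply (Hconv (lam n)); [lra | apply Hsol | exact Hg | exact Hnorm]. }
exists phi; split; [exact Hphi |].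
assert (Hg : forall k, 0 < gam (phi k)).
{ intros k; destruct (HP k) as (_ & Hf & _); apply (Hgam _ Hf). }
assert (HRinv : forall k, 0 < / R0 k ^ 2 <= 1 / R0 k).
{ intros k; assert (K := HR k); split; [apply Rinv_0_lt_compat; nra |].
  unfold Rdiv; rewrite Rmult_1_l; apply Rinv_le_contravar; nra. }
assert (HRR : forall k, R0 k * / R0 k ^ 2 = 1 / R0 k).
{ intros k; assert (K := HR k); field; lra. }
pose (rho := fun k => gam (phi k) * R0 k).
assert (Hrho : forall k, 0 < rho k < 1).
{ intros k; assert (K := HR k); assert (Kg := Hg k).
  destruct (HP k) as (_ & _ & _ & H & _); split; [unfold rho; nra | exact H]. }
assert (Hrg : forall k, rho k / gam (phi k) = R0 k).
{ intros k; assert (Kg := Hg k); unfold rho; field; lra. }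
pose (s := 2 * sqrt 2).
assert (Hs2 : s ^ 2 = 8).
{ unfold s; rewrite Rpow_mult_distr, pow2_sqrt by lra; ring. }
assert (Hs : 0 < s < 4).
{ assert (0 < sqrt 2) by (apply sqrt_lt_R0; lra).
  split; [unfold s; lra | nra]. }
assert (Hur : is_lim_seq (fun n => u (phi n) (gam (phi n) * s) / mu (phi n)) 1).
{ apply is_lim_seq_of_abs_le with 1; intros k; fold (R0 k).
  assert (K := HR k); destruct (HP k) as (_ & _ & _ & _ & H).
  destruct (H s ltac:(lra)) as (_ & _ & _ & B); assert (I := HRinv k); lra. }
exists rho; split; [exact Hrho |].
split; [| split; [| split; [| split; [| split; [| split]]]]].
- apply is_lim_seq_of_abs_le with 1; intros k; fold (R0 k).
  destruct (HP k) as (_ & _ & H & _); assert (I := HRinv k); assert (Kg := Hg k).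
  rewrite Rminus_0_r, Rabs_pos_eq; lra.
- apply is_lim_seq_of_abs_le with 1; intros k; fold (R0 k).
  destruct (HP k) as (_ & _ & H & _); assert (I := HRR k); assert (K := Hrho k).
  rewrite Rminus_0_r, Rabs_pos_eq by lra.
  assert (K4 := HR k); unfold rho; nra.
- apply is_lim_seq_ext with R0; [intros k; symmetry; apply Hrg |].
  apply is_lim_seq_INR_plus.
- apply is_lim_seq_of_abs_le with 1; intros k; fold (R0 k).
  assert (K := HR k); destruct (HP k) as (_ & _ & _ & _ & H).
  destruct (H (R0 k) ltac:(lra)) as (_ & _ & _ & B); assert (I := HRinv k).
  unfold rho; lra.
- intros eps.
  destruct (proj2 (is_lim_seq_spec _ p_infty) (is_lim_seq_INR_plus 4) (2 / eps)) as [N HN].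
  exists N; intros k Hk; specialize (HN k Hk); fold (R0 k) in HN.
  assert (K := HR k); assert (Kg := Hg k); assert (Ke := cond_pos eps).
  destruct (HP k) as (_ & _ & _ & HgR & H).
  rewrite Hrg.
  apply Rbar_le_lt_trans with (Finite (/ R0 k ^ 2 + / R0 k ^ 2)).
  + apply (Rbar_plus_le_compat _ (Finite (/ R0 k ^ 2)) _ (Finite (/ R0 k ^ 2)));
      apply sup_norm_le; intros x Hx.
    * apply (H x Hx).
    * rewrite (is_derive_on_unique _ _ x
        (rescaled' p (mu (phi k)) (gam (phi k)) (u (phi k)) x - z0' x)).
      -- apply (H x Hx).
      -- apply Icc_accumulation; [lra | exact Hx].
      -- assert (Hc : 0 < p * Rpower (mu (phi k)) (p - 1)) by apply slope_pos, Hp.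
         assert (D1 := scaled_derive_on _ _ _ _ (Hsol (phi k))
           (p * Rpower (mu (phi k)) (p - 1)) _ Hc Kg (R0 k) x HgR Hx).
         assert (D2 := is_derive_is_derive_on (Icc 0 (R0 k)) z0 x _ Hx (is_derive_z0 x)).
         exact (is_derive_on_minus _ _ _ _ _ _ D1 D2).
  + change (/ R0 k ^ 2 + / R0 k ^ 2 < eps); assert (I := HRinv k).
    assert (I2 : 2 / R0 k < eps).
    { apply Rmult_lt_reg_r with (R0 k); [lra |].
      unfold Rdiv; rewrite Rmult_assoc, Rinv_l by lra.
      apply Rmult_lt_compat_r with (r := eps) in HN; [| exact Ke].
      replace (2 / eps * eps) with 2 in HN by (field; lra). lra. }
    unfold Rdiv in *; lra.
- apply is_lim_seq_of_abs_le with 9; intros k; fold (R0 k).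
  assert (K := HR k); destruct (HP k) as (_ & _ & _ & _ & H).
  destruct (H (R0 k) ltac:(lra)) as (_ & B & _).
  rewrite (solution_flux _ _ _ _ (Hsol (phi k)));
    [| intros t Ht; apply continuous_nonlin; assumption | apply Hrho].
  assert (E : p * Rpower (mu (phi k)) (p - 1) *
    - (rho k * Derive_on (Icc 0 1) (u (phi k)) (rho k)) - 4 =
    - (R0 k * (rescaled' p (mu (phi k)) (gam (phi k)) (u (phi k)) (R0 k) - z0' (R0 k)))
    + - (32 / (8 + R0 k ^ 2))).
  { unfold rescaled'; fold (rho k); unfold z0', rho; field.
    assert (D := denominator_pos (R0 k)); lra. }
  rewrite E; eapply Rle_trans; [apply Rabs_triang |].
  rewrite !Rabs_Ropp, Rabs_mult, (Rabs_pos_eq (R0 k)) by lra.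
  assert (D := denominator_pos (R0 k)).
  rewrite (Rabs_pos_eq (32 / _)) by (apply Rlt_le, Rdiv_lt_0_compat; lra).
  apply Rmult_le_compat_l with (r := R0 k) in B; [| lra].
  rewrite HRR in B.
  assert (Q : 32 / (8 + R0 k ^ 2) <= 8 / R0 k).
  { apply Rmult_le_reg_r with ((8 + R0 k ^ 2) * R0 k); [nra |].
    replace (32 / (8 + R0 k ^ 2) * ((8 + R0 k ^ 2) * R0 k)) with (32 * R0 k) by (field; lra).
    replace (8 / R0 k * ((8 + R0 k ^ 2) * R0 k)) with (8 * (8 + R0 k ^ 2)) by (field; lra).
    nra. }
  unfold Rdiv in *; lra.
- exists (fun k => gam (phi k) * s).
  split; [| split; [| split]].
  + intros k; assert (K := HR k); assert (Kg := Hg k); unfold rho; split; nra.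
  + apply is_lim_seq_ext with (fun _ => s); [| apply is_lim_seq_const].
    intros k; assert (Kg := Hg k); field; lra.
  + exact Hur.
  + assert (L1 : is_lim_seq (fun n =>
      Rpower (u (phi n) (gam (phi n) * s) / mu (phi n)) (p - 1)) (Rpower 1 (p - 1))).
    { apply (is_lim_seq_continuous (fun y => Rpower y (p - 1)) _ 1); [| exact Hur].
      apply continuity_pt_filterlim.
      apply (ex_derive_continuous (K := R_AbsRing) (V := R_NormedModule)
        (fun y => Rpower y (p - 1))).
      eexists; apply is_derive_Rpower; lra. }
    assert (L2 : is_lim_seq (fun n =>
      nonlin p h (u (phi n) (gam (phi n) * s)) / nonlin p h (mu (phi n))) (exp (z0 s))).
    { apply is_lim_seq_of_abs_le with 1; intros k; fold (R0 k).
      assert (K := HR k); destruct (HP k) as (_ & _ & _ & _ & H).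
      destruct (H s ltac:(lra)) as (_ & _ & B & _); assert (I := HRinv k); lra. }
    assert (L := is_lim_seq_mult' _ _ _ _ (is_lim_seq_const 8)
      (is_lim_seq_mult' _ _ _ _ L1 L2)).
    replace (8 * (Rpower 1 (p - 1) * exp (z0 s))) with 2 in L.
    2: { rewrite exp_z0, Hs2; unfold Rpower; rewrite ln_1, Rmult_0_r, exp_0; field. }
    revert L; apply is_lim_seq_ext; intros k.
    destruct (HP k) as (Hm & Hf & _ & HgR & _); destruct (Hgam _ Hf) as [Kg Hnorm].
    assert (K := HR k).
    assert (Hu : 0 < u (phi k) (gam (phi k) * s)).
    { apply (solution_pos _ _ _ _ (Hsol (phi k))); split; nra. }
    assert (Pm := Rpower_pos (mu (phi k)) (p - 1)).
    assert (EP : Rpower (u (phi k) (gam (phi k) * s)) (p - 1) =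
      Rpower (u (phi k) (gam (phi k) * s) / mu (phi k)) (p - 1) * Rpower (mu (phi k)) (p - 1)).
    { rewrite Rpower_mult_distr; [f_equal; field; lra | apply Rdiv_lt_0_compat; lra | lra]. }
    rewrite EP, Rpow_mult_distr, Hs2.
    apply Rmult_eq_reg_r with (nonlin p h (mu (phi k))); [| lra].
    unfold Rdiv at 2; rewrite !Rmult_assoc, Rinv_l, Rmult_1_r by lra.
    set (A := Rpower (_ / _) _).
    set (fu := nonlin p h (u (phi k) _)).
    transitivity (8 * A * fu * 1); [ring |].
    transitivity (8 * A * fu * (p * lam (phi k) * Rpower (mu (phi k)) (p - 1) *
      nonlin p h (mu (phi k)) * gam (phi k) ^ 2)); [rewrite Hnorm; reflexivity | ring].
Qed.
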